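(* Let $q$ be a complex number with $0<|q|<1$ and let $a,b,c,d$ be complex numbers. (i) If $q=abcd$ and $|q/a|<1$, then $${}_5\psi_5\!\left[\begin{matrix}a^{1/2},-a^{1/2},b,c,d\\ qa^{-1/2},-qa^{-1/2},q/b,q/c,q/d\end{matrix};q,-q\right]=\frac{\left(q,-\frac qa,qa^{1/2},-qa^{1/2};q\right)_\infty}{\left(aq,-q,qa^{-1/2},-qa^{-1/2};q\right)_\infty}\;{}_4\phi_3\!\left[\begin{matrix}a,ab,ac,ad\\ q/b,q/c,q/d\end{matrix};q,-\frac qa\right].$$ (ii) If $q^3=abcd$ and $|q^2/a|<1$, then $${}_5\psi_5\!\left[\begin{matrix}a^{1/2},-a^{1/2},b,c,d\\ q^2a^{-1/2},-q^2a^{-1/2},q^2/b,q^2/c,q^2/d\end{matrix};q,-q\right]=\frac{\left(q,-\frac{q^2}a,qa^{1/2},-qa^{1/2};q\right)_\infty}{\left(aq,-q,q^2a^{-1/2},-q^2a^{-1/2};q\right)_\infty}\;{}_4\phi_3\!\left[\begin{matrix}a,ab/q,ac/q,ad/q\\ q^2/b,q^2/c,q^2/d\end{matrix};q,-\frac{q^2}a\right].$$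
   Context: Notation. $(x;q)_\infty=\prod_{i=0}^\infty(1-xq^i)$ and, for every integer $n$, $(x;q)_n=(x;q)_\infty/(xq^n;q)_\infty$, i.e. $(x;q)_n=\prod_{i=0}^{n-1}(1-xq^i)$ for $n\ge0$ and $(x;q)_{-n}=\prod_{i=1}^{n}(1-xq^{-i})^{-1}$ for $n\geq 1$. For several parameters, $(x_1,\dots,x_s;q)_m=(x_1;q)_m\cdots(x_s;q)_m$. Bilateral series: ${}_s\psi_s\!\left[\begin{matrix}a_1,\dots,a_s\\ c_1,\dots,c_s\end{matrix};q,z\right]=\sum_{k=-\infty}^{\infty}\frac{(a_1,\dots,a_s;q)_k}{(c_1,\dots,c_s;q)_k}z^k.$ Unilateral series: ${}_4\phi_3\!\left[\begin{matrix}a_1,a_2,a_3,a_4\\ c_1,c_2,c_3\end{matrix};q,z\right]=\sum_{k=0}^\infty\frac{(a_1,a_2,a_3,a_4;q)_k}{(q,c_1,c_2,c_3;q)_k}z^k.$ $a^{1/2}$ denotes a square root of $a$ (the same one throughout; both signs occur, so the choice is immaterial) and $a^{-1/2}=1/a^{1/2}$. Standing convention: the parameters are such that every expression occurring is well defined (no denominator vanishes, including the denominator factors of the terms of the series). *)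

(* Defs.v *)
From Stdlib Require Export Reals ZArith List.
From Coquelicot Require Export Coquelicot.
Export ListNotations.

Open Scope R_scope.
Open Scope list_scope.
Open Scope C_scope.

Fixpoint Cprod (f : nat -> C) (n : nat) : C :=
  match n with
  | O => RtoC 1
  | S m => Cprod f m * f m
  end.

(* Limit of a complex sequence, taken componentwise; it is the actual limit
   whenever the sequence converges in [C]. *)
Definition Clim_seq (u : nat -> C) : C :=
  (real (Lim_seq (fun n => fst (u n))), real (Lim_seq (fun n => snd (u n)))).

Definition CSeries (t : nat -> C) : C := Clim_seq (sum_n t).

Definition ex_Cseries (t : nat -> C) : Prop := exists l : C, is_series t l.

(* The sum over all integers k is split as k >= 0 and k = -1, -2, ...;
   convergence means convergence of both halves. *)
Definition bilateral (t : Z -> C) : C :=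
  CSeries (fun n => t (Z.of_nat n)) + CSeries (fun n => t (- Z.of_nat (S n))%Z).

Definition ex_bilateral (t : Z -> C) : Prop :=
  ex_Cseries (fun n => t (Z.of_nat n)) /\
  ex_Cseries (fun n => t (- Z.of_nat (S n))%Z).

Definition CpowZ (z : C) (k : Z) : C :=
  match k with
  | Z0 => RtoC 1
  | Zpos p => z ^ Pos.to_nat p
  | Zneg p => / (z ^ Pos.to_nat p)
  end.

Definition qpoch_inf (x q : C) : C :=
  Clim_seq (Cprod (fun i => RtoC 1 - x * q ^ i)).

(* (x;q)_k for every integer k.  For k = -n < 0 this is the product of the
   (1 - x q^(-i))^(-1), 1 <= i <= n.  Since [/ 0 = 0] in [C], the reciprocal
   / (x;q)_(-n) is always the product of the 1 - x q^(-i), including when this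
   product is 0. *)
Definition qpoch (x q : C) (k : Z) : C :=
  match k with
  | Z0 => RtoC 1
  | Zpos p => Cprod (fun i => RtoC 1 - x * q ^ i) (Pos.to_nat p)
  | Zneg p => Cprod (fun i => / (RtoC 1 - x * / q ^ S i)) (Pos.to_nat p)
  end.

Definition Clist_prod (l : list C) : C := fold_right Cmult (RtoC 1) l.

Definition qpochs (xs : list C) (q : C) (k : Z) : C :=
  Clist_prod (map (fun x => qpoch x q k) xs).

Definition qpochs_inf (xs : list C) (q : C) : C :=
  Clist_prod (map (fun x => qpoch_inf x q) xs).

Definition psi_term (A B : list C) (q z : C) (k : Z) : C :=
  qpochs A q k / qpochs B q k * CpowZ z k.

Definition psi (A B : list C) (q z : C) : C := bilateral (psi_term A B q z).

Definition phi_term (A B : list C) (q z : C) (n : nat) : C :=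
  qpochs A q (Z.of_nat n) / qpochs (q :: B) q (Z.of_nat n) * z ^ n.

(* Used only when A has one entry more than B, in which case the general
   basic hypergeometric series has no additional quadratic factor. *)
Definition phi (A B : list C) (q z : C) : C := CSeries (phi_term A B q z).

(* (x;q)_k has no vanishing denominator, for any integer k. *)
Definition num_wd (q x : C) : Prop :=
  forall i : nat, RtoC 1 - x * / q ^ S i <> RtoC 0.

(* 1/(x;q)_k has no vanishing denominator, for any integer k: only k > 0
   imposes a condition, as 1/(x;q)_(-n) is a product of 1 - x q^(-i). *)
Definition den_wd (q x : C) : Prop :=
  forall i : nat, RtoC 1 - x * q ^ i <> RtoC 0.

Definition psi_wd (A B : list C) (q : C) : Prop :=
  List.Forall (num_wd q) A /\ List.Forall (den_wd q) B.

Definition phi_wd (B : list C) (q : C) : Prop := List.Forall (den_wd q) (q :: B).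

(* Main.v *)
Require Import Defs.
From Stdlib Require Import Lra Lia.

(** Put [p = 1] in (i) and [p = q] in (ii), so that [a b c d = q p^2].  Reflecting
    [k -> -k], resp. [k -> -1-k], folds the bilateral series into a unilateral
    very-well-poised series with base [p].  Jackson's terminating 8phi7 sum with
    base [a] expands the factor [(b,c,d)_n / (pq/b,pq/c,pq/d)_n] of its summand as a sum over
    [j <= n].  After interchanging the sums (absolutely convergent because
    [|pq/a| < 1]), the inner sum over [n >= j] is a nonterminating 6phi5 with base
    [p q^(2j)] and argument [-q]; its evaluation leaves exactly the terms of the 4phi3. *)

(** * Limits and series in [C] *)

(** Folding works because [a b c d = q p^2] makes a reflected term a multiple of the original: for
    the bilateral term [t], [t(-n) = q^n t(n)] if [p = 1] and [t(-1-n) = - q^(2n+1) t(n)] if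
    [p = q]. The resulting factors [1 + q^n] and [1 - q^(2n+1)] are the very-well-poised factors of
    base [p] over [(q;q)_n], the second one up to the constant [1 - q]. The same condition is the
    balancing condition of Jackson's sum with base [a] and parameters
    [ab/p, ac/p, ad/p, p q^n, q^(-n)], for every [n] at once. After the interchange only [p/a] and
    the two square roots of [a] (times [q^j]) remain in the inner sum, which forces the argument
    [-q] whatever [j] is, so all inner sums converge uniformly at rate [|q|].

    The obstacle is degenerate parameters: base 1 is unavoidable in (i), and neither [a = 1] nor all
    the zeros of [(p/a;q)_n] are excluded. Factors such as [1 - A] and [(p/a;q)_n] therefore cannot
    be divided by. Every summand is kept in a form regular at these values, and both classical sums
    are proved by telescoping in that form. *)

Definition Ccv (u : nat -> C) (l : C) : Prop :=
  is_lim_seq (fun n => Cmod (u n - l)) 0%R.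

(** Indices run strictly below [n], whereas [sum_n] includes the last one; hence the shifts by one
    between the two. *)
Fixpoint Csum (t : nat -> C) (n : nat) : C :=
  match n with
  | O => RtoC 0
  | S m => Csum t m + t m
  end.

Definition Ccv_series (t : nat -> C) (l : C) : Prop := Ccv (Csum t) l.

Lemma is_lim_seq_squeeze0 (u v : nat -> R) :
  (forall n, 0 <= u n <= v n)%R -> is_lim_seq v 0%R -> is_lim_seq u 0%R.
Proof.
  intros H Hv.
  apply is_lim_seq_le_le with (u := fun _ => 0%R) (w := v); auto.
  apply is_lim_seq_const.
Qed.

Lemma Ccv_squeeze (u : nat -> C) (l : C) (v : nat -> R) :
  (forall n, Cmod (u n - l) <= v n)%R -> is_lim_seq v 0%R -> Ccv u l.
Proof.
  intros H Hv. apply is_lim_seq_squeeze0 with v; auto.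
  intros n. split; [apply Cmod_ge_0 | apply H].
Qed.

Lemma Ccv_ext (u v : nat -> C) (l : C) :
  (forall n, u n = v n) -> Ccv u l -> Ccv v l.
Proof.
  intros H. apply is_lim_seq_ext. intros n. now rewrite H.
Qed.

Lemma Ccv_const (c : C) : Ccv (fun _ => c) c.
Proof.
  apply is_lim_seq_ext with (fun _ => 0%R); [|apply is_lim_seq_const].
  intros _. replace (c - c) with (RtoC 0) by ring. now rewrite Cmod_0.
Qed.

Lemma Ccv_plus (u v : nat -> C) (l m : C) :
  Ccv u l -> Ccv v m -> Ccv (fun n => u n + v n) (l + m).
Proof.
  intros Hu Hv.
  apply Ccv_squeeze with (fun n => Cmod (u n - l) + Cmod (v n - m))%R.
  - intros n. replace (u n + v n - (l + m)) with ((u n - l) + (v n - m)) by ring.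
    apply Cmod_triangle.
  - replace 0%R with (0 + 0)%R by ring. now apply is_lim_seq_plus'.
Qed.

Lemma Ccv_bounded (u : nat -> C) (l : C) :
  Ccv u l -> exists M, (0 < M)%R /\ forall n, (Cmod (u n) <= M)%R.
Proof.
  intros H.
  assert (Hb : exists M, forall n, (Cmod (u n - l) <= M)%R).
  { apply is_lim_seq_spec in H. destruct (H (mkposreal 1 Rlt_0_1)) as [N HN]. simpl in HN.
    assert (Hf : forall K, exists M, forall n, (n < K)%nat -> (Cmod (u n - l) <= M)%R).
    { induction K as [|K [M HM]]; [exists 0%R; intros; lia|].
      exists (Rmax M (Cmod (u K - l))). intros n Hn.
      destruct (Nat.eq_dec n K) as [->|]; [apply Rmax_r|].
      apply Rle_trans with M; [apply HM; lia | apply Rmax_l]. }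
    destruct (Hf N) as [M HM]. exists (Rmax M 1). intros n.
    destruct (Nat.lt_ge_cases n N) as [Hn|Hn].
    - apply Rle_trans with M; [auto | apply Rmax_l].
    - specialize (HN n Hn). rewrite Rminus_0_r, Rabs_pos_eq in HN by apply Cmod_ge_0.
      apply Rle_trans with 1%R; [lra | apply Rmax_r]. }
  destruct Hb as [M HM]. exists (Rmax M 0 + Cmod l + 1)%R. split.
  - pose proof (Rmax_r M 0). pose proof (Cmod_ge_0 l). lra.
  - intros n. replace (u n) with ((u n - l) + l) by ring.
    pose proof (Cmod_triangle (u n - l) l). pose proof (HM n). pose proof (Rmax_l M 0). lra.
Qed.

Lemma Ccv_mult (u v : nat -> C) (l m : C) :
  Ccv u l -> Ccv v m -> Ccv (fun n => u n * v n) (l * m).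
Proof.
  intros Hu Hv. destruct (Ccv_bounded _ _ Hu) as [M [HM0 HM]].
  apply Ccv_squeeze with (fun n => M * Cmod (v n - m) + Cmod m * Cmod (u n - l))%R.
  - intros n. replace (u n * v n - l * m) with (u n * (v n - m) + m * (u n - l)) by ring.
    eapply Rle_trans; [apply Cmod_triangle|]. rewrite !Cmod_mult.
    apply Rplus_le_compat_r, Rmult_le_compat_r; [apply Cmod_ge_0 | apply HM].
  - replace 0%R with (M * 0 + Cmod m * 0)%R by ring.
    apply is_lim_seq_plus'; apply (is_lim_seq_scal_l _ _ (Finite 0)); assumption.
Qed.

Lemma Ccv_scal (c : C) (u : nat -> C) (l : C) :
  Ccv u l -> Ccv (fun n => c * u n) (c * l).
Proof. intros H. apply Ccv_mult; [apply Ccv_const | exact H]. Qed.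

Lemma Ccv_unique (u : nat -> C) (l m : C) : Ccv u l -> Ccv u m -> l = m.
Proof.
  intros Hl Hm.
  assert (H : Ccv (fun _ => RtoC 0) (l - m)).
  { apply Ccv_ext with (fun n => u n + (-(1)) * u n); [intros; ring|].
    replace (l - m) with (-(1) * m + l) by ring.
    apply Ccv_ext with (fun n => (-(1)) * u n + u n); [intros; ring|].
    apply Ccv_plus; auto. now apply Ccv_scal. }
  unfold Ccv in H. apply is_lim_seq_unique in H. rewrite Lim_seq_const in H.
  injection H as H. apply Cmod_eq_0 in H.
  replace l with (l - m + m) by ring.
  replace (l - m) with (- (0 - (l - m))) by ring. rewrite H. ring.
Qed.

Lemma Ccv_incr (u : nat -> C) (l : C) (k : nat) :
  Ccv u l -> Ccv (fun n => u (n + k)%nat) l.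
Proof. intros H. now apply (is_lim_seq_incr_n (fun n => Cmod (u n - l)) k). Qed.

Lemma Ccv_incr_1 (u : nat -> C) (l : C) : Ccv (fun n => u (S n)) l -> Ccv u l.
Proof. intros H. now apply (is_lim_seq_incr_1 (fun n => Cmod (u n - l))). Qed.

Lemma Ccv_le (u : nat -> C) (l c : C) (M : R) :
  Ccv u l -> (forall n, Cmod (u n - c) <= M)%R -> (Cmod (l - c) <= M)%R.
Proof.
  intros H HM. apply le_epsilon. intros eps Heps.
  apply is_lim_seq_spec in H. destruct (H (mkposreal eps Heps)) as [N HN]. simpl in HN.
  specialize (HN N (Nat.le_refl _)). rewrite Rminus_0_r, Rabs_pos_eq in HN by apply Cmod_ge_0.
  replace (l - c) with (-(u N - l) + (u N - c)) by ring.
  eapply Rle_trans; [apply Cmod_triangle|]. rewrite Cmod_opp. specialize (HM N). lra.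
Qed.

(** The norm ball of [C_NormedModule] is the [Cmod] ball, so both sides are the same epsilon
    statement. *)
Lemma Ccv_filterlim (u : nat -> C) (l : C) :
  Ccv u l <-> filterlim u eventually (locally l).
Proof.
  split; intros H.
  - apply (@filterlim_locally_ball_norm C_AbsRing nat C_NormedModule eventually _ u l). intros eps.
    apply is_lim_seq_spec in H. destruct (H eps) as [N HN].
    exists N. intros n Hn. specialize (HN n Hn).
    rewrite Rminus_0_r, Rabs_pos_eq in HN by apply Cmod_ge_0.
    exact HN.
  - apply is_lim_seq_spec. intros eps.
    pose proof (proj1 (@filterlim_locally_ball_norm C_AbsRing nat C_NormedModule eventually _ u l) H eps) as H'.
    destruct H' as [N HN]. exists N. intros n Hn. specialize (HN n Hn).
    rewrite Rminus_0_r, Rabs_pos_eq by apply Cmod_ge_0.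
    exact HN.
Qed.

(** Each component of [u n - l] is at most its modulus. This carries modulus convergence over to the
    componentwise limits used by [psi], [phi] and [qpoch_inf]. *)
Lemma Clim_seq_unique (u : nat -> C) (l : C) : Ccv u l -> Clim_seq u = l.
Proof.
  intros H. unfold Clim_seq.
  assert (Hf : is_lim_seq (fun n => fst (u n)) (fst l)).
  { apply is_lim_seq_ext with (fun n => (fst (u n) - fst l) + fst l)%R; [intros; ring|].
    replace (Finite (fst l)) with (Finite (0 + fst l)%R) by (f_equal; ring).
    apply is_lim_seq_plus'; [|apply is_lim_seq_const].
    apply is_lim_seq_abs_0. apply is_lim_seq_squeeze0 with (2 := H).
    intros n. split; [apply Rabs_pos|].
    eapply Rle_trans; [|apply Rmax_Cmod]. apply Rmax_l. }
  assert (Hs : is_lim_seq (fun n => snd (u n)) (snd l)).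
  { apply is_lim_seq_ext with (fun n => (snd (u n) - snd l) + snd l)%R; [intros; ring|].
    replace (Finite (snd l)) with (Finite (0 + snd l)%R) by (f_equal; ring).
    apply is_lim_seq_plus'; [|apply is_lim_seq_const].
    apply is_lim_seq_abs_0. apply is_lim_seq_squeeze0 with (2 := H).
    intros n. split; [apply Rabs_pos|].
    eapply Rle_trans; [|apply Rmax_Cmod]. apply Rmax_r. }
  rewrite (is_lim_seq_unique _ _ Hf), (is_lim_seq_unique _ _ Hs).
  now destruct l.
Qed.

Lemma Csum_ext (t u : nat -> C) (n : nat) :
  (forall k, (k < n)%nat -> t k = u k) -> Csum t n = Csum u n.
Proof.
  induction n as [|n IH]; intros H; [reflexivity|].
  simpl. rewrite IH, H by (intros; try apply H; lia). reflexivity.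
Qed.

Lemma Csum_plus (t u : nat -> C) (n : nat) :
  Csum (fun k => t k + u k) n = Csum t n + Csum u n.
Proof. induction n as [|n IH]; simpl; [ring|]. rewrite IH. ring. Qed.

Lemma Csum_scal (c : C) (t : nat -> C) (n : nat) :
  Csum (fun k => c * t k) n = c * Csum t n.
Proof. induction n as [|n IH]; simpl; [ring|]. rewrite IH. ring. Qed.

Lemma Csum_S_l (t : nat -> C) (n : nat) :
  Csum t (S n) = t O + Csum (fun k => t (S k)) n.
Proof.
  induction n as [|n IH]; [simpl; ring|].
  change (Csum t (S (S n))) with (Csum t (S n) + t (S n)). rewrite IH. simpl. ring.
Qed.

Lemma sum_n_Csum (t : nat -> C) (n : nat) : sum_n t n = Csum t (S n).
Proof.
  induction n as [|n IH].
  - rewrite sum_O. simpl. ring.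
  - rewrite sum_Sn, IH. reflexivity.
Qed.

Lemma Ccv_series_is_series (t : nat -> C) (l : C) : Ccv_series t l <-> is_series t l.
Proof.
  unfold is_series. rewrite <- Ccv_filterlim. split; intros H.
  - apply Ccv_ext with (fun n => Csum t (n + 1)).
    + intros n. now rewrite sum_n_Csum, Nat.add_1_r.
    + now apply Ccv_incr.
  - apply Ccv_incr_1. apply Ccv_ext with (2 := H). apply sum_n_Csum.
Qed.

Lemma CSeries_unique (t : nat -> C) (l : C) : Ccv_series t l -> CSeries t = l.
Proof.
  intros H. apply Clim_seq_unique, Ccv_filterlim.
  now apply Ccv_series_is_series in H.
Qed.

Lemma Csum_geom_bound (t : nat -> C) (M r : R) (k n : nat) :
  (0 <= r < 1)%R -> (0 <= M)%R -> (forall i, Cmod (t i) <= M * r ^ i)%R ->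
  (Cmod (Csum t (n + k) - Csum t k) <= M * r ^ k / (1 - r))%R.
Proof.
  intros Hr HM Ht.
  (* The exact finite geometric sum is the bound that is stable under induction; the factor
     [1 - r ^ n] is dropped afterwards. *)
  assert (H : (Cmod (Csum t (n + k) - Csum t k) <= M * r ^ k * (1 - r ^ n) / (1 - r))%R).
  { induction n as [|n IH].
    - simpl. replace (Csum t k - Csum t k) with (RtoC 0) by ring. rewrite Cmod_0. apply Req_le. field. lra.
    - simpl. replace (Csum t (n + k) + t (n + k)%nat - Csum t k)
        with ((Csum t (n + k) - Csum t k) + t (n + k)%nat) by ring.
      eapply Rle_trans; [apply Cmod_triangle|].
      eapply Rle_trans; [apply Rplus_le_compat; [apply IH | apply Ht]|].
      rewrite pow_add. apply Req_le. field. lra. }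
  eapply Rle_trans; [apply H|]. unfold Rdiv. apply Rmult_le_compat_r.
  - apply Rlt_le, Rinv_0_lt_compat. lra.
  - rewrite <- (Rmult_1_r (M * r ^ k)) at 2. apply Rmult_le_compat_l.
    + apply Rmult_le_pos; [auto | apply pow_le; lra].
    + pose proof (pow_le r n). lra.
Qed.

Lemma Ccv_series_geom (t : nat -> C) (M r : R) :
  (0 <= r < 1)%R -> (forall i, Cmod (t i) <= M * r ^ i)%R ->
  exists l, Ccv_series t l.
Proof.
  intros Hr Ht.
  assert (H : ex_series t).
  { apply (@ex_series_le C_AbsRing C_CompleteNormedModule t (fun i => M * r ^ i)%R).
    - exact Ht.
    - apply (@ex_series_scal_l R_AbsRing R_NormedModule M (fun i => r ^ i)%R). apply ex_series_geom. rewrite Rabs_pos_eq; lra. }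
  destruct H as [l Hl]. exists l. now apply Ccv_series_is_series.
Qed.

(** The bound depends on [t] only through [M] and [r], so it is uniform over families of series. *)
Lemma Ccv_series_tail_bound (t : nat -> C) (l : C) (M r : R) (k : nat) :
  (0 <= r < 1)%R -> (0 <= M)%R -> (forall i, Cmod (t i) <= M * r ^ i)%R ->
  Ccv_series t l -> (Cmod (l - Csum t k) <= M * r ^ k / (1 - r))%R.
Proof.
  intros Hr HM Ht Hl. apply Ccv_le with (fun n => Csum t (n + k)).
  - now apply Ccv_incr.
  - intros n. now apply Csum_geom_bound.
Qed.

(** The Cauchy square of the geometric series converges and has general term [(n+1) r^n]. *)
Lemma lim_mult_geom (r : R) :
  (0 <= r < 1)%R -> is_lim_seq (fun n => INR (S n) * r ^ n)%R 0%R.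
Proof.
  intros Hr.
  assert (H : is_series (fun n => r ^ n)%R (/ (1 - r))%R)
    by (apply is_series_geom; rewrite Rabs_pos_eq; lra).
  assert (H0 : forall n, (0 <= r ^ n)%R) by (intros; apply pow_le; lra).
  pose proof (is_series_mult_pos _ _ _ _ H H H0 H0) as H1.
  apply is_lim_seq_ext with (2 := ex_series_lim_0 _ (ex_intro _ _ H1)).
  intros n. rewrite <- (sum_eq (fun _ => r ^ n)%R).
  - rewrite sum_cte. ring.
  - intros i Hi. rewrite <- pow_add. f_equal. lia.
Qed.

(** Summation of the triangle [j + m < N] by antidiagonals on one side, by rows on the other. *)
Lemma Csum_triangle (v : nat -> nat -> C) (N : nat) :
  Csum (fun n => Csum (fun j => v j (n - j)%nat) (S n)) N
  = Csum (fun j => Csum (v j) (N - j)) N.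
Proof.
  induction N as [|N IH]; [reflexivity|].
  change (Csum (fun n => Csum (fun j => v j (n - j)%nat) (S n)) (S N))
    with (Csum (fun n => Csum (fun j => v j (n - j)%nat) (S n)) N
          + Csum (fun j => v j (N - j)%nat) (S N)).
  rewrite IH.
  transitivity (Csum (fun j => Csum (v j) (N - j) + v j (N - j)%nat) (S N)).
  - rewrite Csum_plus. f_equal. simpl. rewrite Nat.sub_diag. simpl. ring.
  - apply Csum_ext. intros j Hj. now replace (S N - j)%nat with (S (N - j)) by lia.
Qed.

Lemma Cmod_Csum_le (f : nat -> C) (K : R) (n : nat) :
  (forall j, (j < n)%nat -> (Cmod (f j) <= K)%R) -> (Cmod (Csum f n) <= INR n * K)%R.
Proof.
  induction n as [|n IH]; intros Hf.
  - simpl. rewrite Cmod_0. lra.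
  - change (Csum f (S n)) with (Csum f n + f n).
    rewrite S_INR, Rmult_plus_distr_r, Rmult_1_l.
    eapply Rle_trans; [apply Cmod_triangle|]. apply Rplus_le_compat; auto.
Qed.

(** Summing the triangle [j + m < N] instead of [N] full rows omits one tail per row. The tail of
    row [j] starts at [m = N - j], so each is at most [M r^N / (1 - r)], and [N] of them still tend
    to 0. *)
Lemma Ccv_series_triangle (v : nat -> nat -> C) (V : nat -> C) (L : C) (M r : R) :
  (0 <= r < 1)%R -> (0 <= M)%R -> (forall j m, Cmod (v j m) <= M * r ^ (j + m))%R ->
  (forall j, Ccv_series (v j) (V j)) -> Ccv_series V L ->
  Ccv_series (fun n => Csum (fun j => v j (n - j)%nat) (S n)) L.
Proof.
  intros Hr HM Hv HV HL. unfold Ccv_series.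
  (* The sum of the omitted row tails, with opposite sign. *)
  assert (Hd : Ccv (fun N => Csum (fun j => Csum (v j) (N - j) + (-(1)) * V j) N) 0).
  { apply Ccv_incr_1.
    apply Ccv_squeeze with (fun N => M * r / (1 - r) * (INR (S N) * r ^ N))%R.
    - intros N. replace (M * r / (1 - r) * (INR (S N) * r ^ N))%R
        with (INR (S N) * (M * r ^ S N / (1 - r)))%R by (simpl pow; field; lra).
      set (K := (M * r ^ S N / (1 - r))%R).
      assert (HK : forall j, (j < S N)%nat ->
        (Cmod (Csum (v j) (S N - j) + -(1) * V j) <= K)%R).
      { intros j Hj. replace (Csum (v j) (S N - j) + -(1) * V j)
          with (- (V j - Csum (v j) (S N - j))) by ring. rewrite Cmod_opp.
        unfold K. replace (r ^ S N)%R with (r ^ j * r ^ (S N - j))%R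
          by (rewrite <- pow_add; f_equal; lia). rewrite <- Rmult_assoc.
        apply Ccv_series_tail_bound; auto.
        - apply Rmult_le_pos; auto. apply pow_le; lra.
        - intros i. rewrite Rmult_assoc, <- pow_add. apply Hv. }
      replace (Csum (fun j => Csum (v j) (S N - j) + -(1) * V j) (S N) - 0)
        with (Csum (fun j => Csum (v j) (S N - j) + -(1) * V j) (S N)) by ring.
      now apply Cmod_Csum_le.
    - replace 0%R with (M * r / (1 - r) * 0)%R by ring.
      apply (is_lim_seq_scal_l _ _ (Finite 0)). now apply lim_mult_geom. }
  apply Ccv_ext with (fun N => Csum (fun j => Csum (v j) (N - j) + (-(1)) * V j) N + Csum V N).
  - intros N. rewrite Csum_triangle, Csum_plus, Csum_scal. ring.
  - replace L with (0 + L) by ring. now apply Ccv_plus.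
Qed.

(** * Finite and infinite q-shifted factorials *)

Definition poch (x q : C) (n : nat) : C := Cprod (fun i => 1 - x * q ^ i) n.

Lemma poch_0 (x q : C) : poch x q 0 = 1.
Proof. reflexivity. Qed.

Lemma poch_S (x q : C) (n : nat) : poch x q (S n) = poch x q n * (1 - x * q ^ n).
Proof. reflexivity. Qed.

Lemma poch_add (x q : C) (m n : nat) :
  poch x q (m + n) = poch x q m * poch (x * q ^ m) q n.
Proof.
  induction n as [|n IH].
  - rewrite Nat.add_0_r, poch_0. ring.
  - rewrite Nat.add_succ_r, !poch_S, IH, Cpow_add_r. ring.
Qed.

Lemma poch_S_l (x q : C) (n : nat) : poch x q (S n) = (1 - x) * poch (x * q) q n.
Proof.
  change (S n) with (1 + n)%nat. rewrite poch_add. cbn. f_equal; [ring|].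
  f_equal. ring.
Qed.

Lemma poch_neq_0 (x q : C) (n : nat) : den_wd q x -> poch x q n <> 0.
Proof.
  intros H. induction n as [|n IH]; [apply C1_nz|].
  rewrite poch_S. apply Cmult_neq_0; auto.
Qed.

Lemma den_wd_shift (x q : C) (k : nat) : den_wd q x -> den_wd q (x * q ^ k).
Proof. intros H i. rewrite <- Cmult_assoc, <- Cpow_add_r. apply H. Qed.

Lemma Cmod_one_minus_le (z : C) : (Cmod (1 - z) <= 1 + Cmod z)%R.
Proof.
  pose proof (Cmod_triangle 1 (- z)) as H. rewrite Cmod_1, Cmod_opp in H. exact H.
Qed.

Lemma Cmod_one_minus_ge (z : C) : (1 - Cmod z <= Cmod (1 - z))%R.
Proof.
  pose proof (Cmod_triangle (1 - z) z) as H. replace (1 - z + z) with (RtoC 1) in H by ring.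
  rewrite Cmod_1 in H. lra.
Qed.

(** Each factor is at most [1 + |x||q|^i <= exp (|x||q|^i)], and the exponents form a geometric
    series. *)
Lemma Cmod_poch_le_exp (x q : C) (n : nat) :
  (Cmod q < 1)%R -> (Cmod (poch x q n) <= exp (Cmod x / (1 - Cmod q)))%R.
Proof.
  intros Hq. pose proof (Cmod_ge_0 q) as Hq0. pose proof (Cmod_ge_0 x) as Hx0.
  assert (H : (Cmod (poch x q n) <= exp (Cmod x * (1 - Cmod q ^ n) / (1 - Cmod q)))%R).
  { induction n as [|n IH].
    - rewrite poch_0, Cmod_1. replace (Cmod x * (1 - Cmod q ^ 0) / (1 - Cmod q))%R with 0%R
        by (simpl; field; lra). rewrite exp_0. lra.
    - rewrite poch_S, Cmod_mult.
      replace (Cmod x * (1 - Cmod q ^ S n) / (1 - Cmod q))%R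
        with (Cmod x * (1 - Cmod q ^ n) / (1 - Cmod q) + Cmod x * Cmod q ^ n)%R
        by (simpl; field; lra).
      rewrite exp_plus. apply Rmult_le_compat; auto using Cmod_ge_0.
      eapply Rle_trans; [apply Cmod_one_minus_le|]. rewrite Cmod_mult, Cmod_pow.
      apply exp_ineq1_le. }
  eapply Rle_trans; [apply H|].
  destruct (Rle_lt_or_eq_dec (Cmod x * (1 - Cmod q ^ n) / (1 - Cmod q)) (Cmod x / (1 - Cmod q))) as [H1|H1].
  - unfold Rdiv. apply Rmult_le_compat_r; [apply Rlt_le, Rinv_0_lt_compat; lra|].
    pose proof (pow_le _ n Hq0). nra.
  - apply Rlt_le, exp_increasing, H1.
  - rewrite H1. lra.
Qed.

(** Uniformity in the shift [k], not only in [n], is what the [j]-dependent parameters of the inner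
    sums require. *)
Lemma poch_upper (x q : C) :
  (Cmod q < 1)%R ->
  exists M, (0 < M)%R /\ forall k n, (Cmod (poch (x * q ^ k) q n) <= M)%R.
Proof.
  intros Hq. exists (exp (Cmod x / (1 - Cmod q))). split; [apply exp_pos|].
  intros k n. eapply Rle_trans; [now apply Cmod_poch_le_exp|].
  assert (H : (Cmod (x * q ^ k) / (1 - Cmod q) <= Cmod x / (1 - Cmod q))%R).
  { unfold Rdiv. apply Rmult_le_compat_r; [apply Rlt_le, Rinv_0_lt_compat; lra|].
    rewrite Cmod_mult, Cmod_pow. rewrite <- (Rmult_1_r (Cmod x)) at 2.
    apply Rmult_le_compat_l; [apply Cmod_ge_0|].
    rewrite <- (pow1 k). apply pow_incr. split; [apply Cmod_ge_0 | lra]. }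
  destruct (Rle_lt_or_eq_dec _ _ H) as [H1|H1].
  - apply Rlt_le, exp_increasing, H1.
  - rewrite H1. lra.
Qed.

(** Weierstrass's inequality: a product of [1 - t_i] is at least [1] minus the sum of the [t_i],
    which here is at most [1/2]. *)
Lemma Cmod_poch_ge (x q : C) (n : nat) :
  (Cmod q < 1)%R -> (Cmod x / (1 - Cmod q) <= 1 / 2)%R -> (1 / 2 <= Cmod (poch x q n))%R.
Proof.
  intros Hq Hx. pose proof (Cmod_ge_0 q) as Hq0. pose proof (Cmod_ge_0 x) as Hx0.
  assert (Hi : (0 < / (1 - Cmod q))%R) by (apply Rinv_0_lt_compat; lra).
  assert (Hx' : (0 <= Cmod x / (1 - Cmod q))%R) by (unfold Rdiv; nra).
  assert (H : (1 - Cmod x / (1 - Cmod q) * (1 - Cmod q ^ n) <= Cmod (poch x q n))%R).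
  { induction n as [|n IH].
    - rewrite poch_0, Cmod_1. simpl. lra.
    - rewrite poch_S, Cmod_mult.
      pose proof (Cmod_one_minus_ge (x * q ^ n)) as H1. rewrite Cmod_mult, Cmod_pow in H1.
      replace (Cmod x / (1 - Cmod q) * (1 - Cmod q ^ S n))%R with
        (Cmod x / (1 - Cmod q) * (1 - Cmod q ^ n) + Cmod x * Cmod q ^ n)%R by (simpl; field; lra).
      assert (Hp : (0 <= Cmod q ^ n <= 1)%R).
      { split; [now apply pow_le|]. rewrite <- (pow1 n). apply pow_incr. lra. }
      set (A := (Cmod x / (1 - Cmod q) * (1 - Cmod q ^ n))%R) in *.
      assert (HA : (0 <= A <= 1/2)%R) by (unfold A; nra).
      set (B := (Cmod x * Cmod q ^ n)%R) in *.
      assert (HB : (0 <= B <= 1)%R).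
      { unfold B. assert (Cmod x <= 1)%R.
        { replace (Cmod x) with (Cmod x / (1 - Cmod q) * (1 - Cmod q))%R by (field; lra). nra. }
        nra. }
      apply Rle_trans with ((1 - A) * (1 - B))%R; [nra|].
      apply Rmult_le_compat; lra. }
  assert (Hp : (0 <= Cmod q ^ n)%R) by now apply pow_le.
  nra.
Qed.

(** Beyond some [K] the shifted products stay above [1/2]; the finitely many earlier ones are
    nonzero. This bounds [(x;q)_n] from below. The shift [k] then comes for free, since
    [1/(x q^k;q)_n = (x;q)_k / (x;q)_(k+n)]. *)
Lemma poch_lower (x q : C) :
  (Cmod q < 1)%R -> den_wd q x ->
  exists M, (0 < M)%R /\ forall k n, (Cmod (/ poch (x * q ^ k) q n) <= M)%R.
Proof.
  intros Hq Hx.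
  assert (HK : exists K, (Cmod (x * q ^ K) / (1 - Cmod q) <= 1 / 2)%R).
  { assert (Hl : is_lim_seq (fun n => Cmod x / (1 - Cmod q) * Cmod q ^ n)%R 0%R).
    { replace 0%R with (Cmod x / (1 - Cmod q) * 0)%R by ring.
      apply (is_lim_seq_scal_l _ _ (Finite 0)). apply is_lim_seq_geom.
      rewrite Rabs_pos_eq; [auto | apply Cmod_ge_0]. }
    apply is_lim_seq_spec in Hl. assert (Hh : (0 < 1 / 2)%R) by lra.
    destruct (Hl (mkposreal _ Hh)) as [K HK]. exists K.
    specialize (HK K (Nat.le_refl _)). simpl in HK. apply Rabs_def2 in HK.
    rewrite Cmod_mult, Cmod_pow.
    replace (Cmod x * Cmod q ^ K / (1 - Cmod q))%R
      with (Cmod x / (1 - Cmod q) * Cmod q ^ K)%R by (field; lra). lra. }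
  destruct HK as [K HK].
  assert (Hf : forall N, exists d, (0 < d)%R /\ forall n, (n < N)%nat -> (d <= Cmod (poch x q n))%R).
  { induction N as [|N [d [Hd H]]]; [exists 1%R; split; [lra | intros; lia]|].
    exists (Rmin d (Cmod (poch x q N))). split.
    - apply Rmin_pos; auto. apply Cmod_gt_0. now apply poch_neq_0.
    - intros n Hn. destruct (Nat.eq_dec n N) as [->|]; [apply Rmin_r|].
      apply Rle_trans with d; [apply Rmin_l | apply H; lia]. }
  destruct (Hf (S K)) as [d [Hd H]].
  assert (Hall : forall n, (d / 2 <= Cmod (poch x q n))%R).
  { intros n. destruct (Nat.lt_ge_cases n (S K)) as [Hn|Hn].
    - specialize (H n Hn). lra.
    - replace n with (K + (n - K))%nat by lia. rewrite poch_add, Cmod_mult.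
      pose proof (Cmod_poch_ge _ _ (n - K) Hq HK). specialize (H K (Nat.lt_succ_diag_r _)). nra. }
  destruct (poch_upper x q Hq) as [M [HM HMu]].
  exists (M / (d / 2))%R. split; [apply Rdiv_lt_0_compat; lra|].
  intros k n. assert (Hk : poch x q k <> 0) by now apply poch_neq_0.
  assert (Hn : poch (x * q ^ k) q n <> 0) by now apply poch_neq_0, den_wd_shift.
  replace (/ poch (x * q ^ k) q n) with (poch x q k / poch x q (k + n)).
  2:{ rewrite poch_add. field. auto. }
  rewrite Cmod_div by now apply poch_neq_0.
  unfold Rdiv at 1 2. apply Rmult_le_compat.
  - apply Cmod_ge_0.
  - apply Rlt_le, Rinv_0_lt_compat. specialize (Hall (k + n)%nat). lra.
  - specialize (HMu O k). cbn [Cpow] in HMu. now rewrite Cmult_1_r in HMu.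
  - apply Rinv_le_contravar; [lra | apply Hall].
Qed.

(** Consecutive partial products differ by [-(x;q)_n x q^n], so the product is a series dominated by
    a geometric one. *)
Lemma qpoch_inf_cv (x q : C) : (Cmod q < 1)%R -> Ccv (poch x q) (qpoch_inf x q).
Proof.
  intros Hq. destruct (poch_upper x q Hq) as [M [HM HMu]].
  assert (H : exists l, Ccv_series (fun i => - poch x q i * x * q ^ i) l).
  { apply Ccv_series_geom with (M * Cmod x)%R (Cmod q).
    - pose proof (Cmod_ge_0 q). lra.
    - intros i. rewrite !Cmod_mult, Cmod_opp, Cmod_pow.
      apply Rmult_le_compat_r; [apply pow_le, Cmod_ge_0|].
      apply Rmult_le_compat_r; [apply Cmod_ge_0|].
      specialize (HMu O i). cbn [Cpow] in HMu. now rewrite Cmult_1_r in HMu. }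
  destruct H as [l Hl].
  assert (Hc : Ccv (poch x q) (1 + l)).
  { apply Ccv_ext with (fun n => 1 + Csum (fun i => - poch x q i * x * q ^ i) n).
    - induction n as [|n IH]; [cbn; ring|].
      cbn [Csum]. rewrite poch_S, Cplus_assoc, IH. ring.
    - apply Ccv_plus; [apply Ccv_const | exact Hl]. }
  replace (qpoch_inf x q) with (1 + l); auto.
  symmetry. now apply Clim_seq_unique.
Qed.

Lemma qpoch_inf_shift (x q : C) (k : nat) :
  (Cmod q < 1)%R -> qpoch_inf x q = poch x q k * qpoch_inf (x * q ^ k) q.
Proof.
  intros Hq. apply Ccv_unique with (fun n => poch x q (n + k)).
  - apply Ccv_incr. now apply qpoch_inf_cv.
  - apply Ccv_ext with (fun n => poch x q k * poch (x * q ^ k) q n).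
    + intros n. now rewrite Nat.add_comm, poch_add.
    + apply Ccv_scal. now apply qpoch_inf_cv.
Qed.

(** A vanishing factor can be split off the infinite product; conversely, if no factor vanishes,
    [poch_lower] keeps the partial products away from 0. *)
Lemma qpoch_inf_neq_0 (x q : C) : (Cmod q < 1)%R -> qpoch_inf x q <> 0 <-> den_wd q x.
Proof.
  intros Hq. split.
  - intros H i Hi. apply H. rewrite (qpoch_inf_shift x q (S i) Hq), poch_S, Hi. ring.
  - intros H H0. destruct (poch_lower x q Hq H) as [M [HM HMl]].
    pose proof (qpoch_inf_cv x q Hq) as Hc. rewrite H0 in Hc.
    apply is_lim_seq_spec in Hc.
    destruct (Hc (mkposreal (/ M) (Rinv_0_lt_compat _ HM))) as [N HN]. simpl in HN.
    specialize (HN N (Nat.le_refl _)). rewrite Rminus_0_r, Rabs_pos_eq in HN by apply Cmod_ge_0.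
    specialize (HMl O N). cbn [Cpow] in HMl. rewrite Cmult_1_r in HMl.
    assert (Hp : poch x q N <> 0) by now apply poch_neq_0.
    replace (poch x q N - 0) with (poch x q N) in HN by ring.
    rewrite Cmod_inv in HMl by auto.
    apply Cmod_gt_0 in Hp. apply Rinv_le_contravar in HMl; [|now apply Rinv_0_lt_compat].
    rewrite Rinv_inv in HMl. lra.
Qed.

(** * The nonterminating 6phi5 sum *)

(* [(1 - A q^(2n)) (A;q)_n / (1 - A)], in a form that still makes sense at [A = 1]. *)
Definition vwp (A q : C) (n : nat) : C :=
  match n with
  | O => 1
  | S m => (1 - A * q ^ (2 * n)) * poch (A * q) q m
  end.

(** Clearing fractions makes [field] ask for conditions such as [b - A q y <> 0], which differ from
    the available [1 - A q / b * y <> 0] by a nonzero multiple [k]. *)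
Lemma neq_0_scale (k u v : C) : k <> 0 -> u <> 0 -> v = k * u -> v <> 0.
Proof. intros Hk Hu ->. now apply Cmult_neq_0. Qed.

(** The telescoping relation of [phi65_telescope] for one term, with [y = q^n] and all shifted
    factorials cancelled: the right side is the increment of [phi65_rest]. *)
Lemma phi65_core (A q b c d y : C) :
  b <> 0 -> c <> 0 -> d <> 0 ->
  1 - A * q / b * y <> 0 -> 1 - A * q / c * y <> 0 -> 1 - A * q / d * y <> 0 ->
  1 - A * q / (b * c * d) <> 0 ->
  (1 - A * y ^ 2)
  - y * (1 - A * q * y ^ 2) * (1 - A * y)
    * ((1 - A * q / (b * c)) * (1 - A * q / (b * d)) * (1 - A * q / (c * d)))
    / ((1 - A * q / b * y) * (1 - A * q / c * y) * (1 - A * q / d * y)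
       * (1 - A * q / (b * c * d)))
  = ((1 - y) * (1 - A * q / (b * c * d) * A * y)
     - A * q / (b * c * d) * (1 - A * y) * (1 - b * y) * (1 - c * y) * (1 - d * y)
       * (1 - A * q / (b * c * d) * A * q * y)
       / ((1 - A * q / b * y) * (1 - A * q / c * y) * (1 - A * q / d * y)))
    / (1 - A * q / (b * c * d)).
Proof.
  intros Hb Hc Hd H1 H2 H3 H4. field.
  repeat split; auto.
  - apply (neq_0_scale d _ _ Hd H3). field; auto.
  - apply (neq_0_scale c _ _ Hc H2). field; auto.
  - apply (neq_0_scale b _ _ Hb H1). field; auto.
  - apply (neq_0_scale (b * c * d) _ _) with (2 := H4); [|field; auto].
    repeat apply Cmult_neq_0; auto.
Qed.

Definition phi65 (A b c d q : C) (n : nat) : C :=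
  vwp A q n / poch q q n
  * (poch b q n * poch c q n * poch d q n
     / (poch (A * q / b) q n * poch (A * q / c) q n * poch (A * q / d) q n))
  * (A * q / (b * c * d)) ^ n.

(** Quotient of the closed forms of the 6phi5 sum at [A] and at [A q]. *)
Definition phi65_ratio (A b c d q : C) : C :=
  (1 - A * q) * ((1 - A * q / (b * c)) * (1 - A * q / (b * d)) * (1 - A * q / (c * d)))
  / ((1 - A * q / b) * (1 - A * q / c) * (1 - A * q / d) * (1 - A * q / (b * c * d))).

(** Antidifference of [phi65 A - phi65_ratio * phi65 (A q)]; it decays like the argument to the
    power [n + 1]. *)
Definition phi65_rest (A b c d q : C) (n : nat) : C :=
  - (poch (A * q) q n / poch q q n
     * (poch b q (S n) * poch c q (S n) * poch d q (S n)
        / (poch (A * q / b) q (S n) * poch (A * q / c) q (S n) * poch (A * q / d) q (S n)))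
     * (A * q / (b * c * d)) ^ S n
     * ((1 - A * q / (b * c * d) * A * q ^ S n) / (1 - A * q / (b * c * d)))).

Lemma poch_shift_div (x q : C) (n : nat) :
  1 - x <> 0 -> poch (x * q) q n = poch x q n * (1 - x * q ^ n) / (1 - x).
Proof.
  intros H. rewrite <- poch_S, poch_S_l. field. exact H.
Qed.

Lemma den_wd_0 (q x : C) : den_wd q x -> 1 - x <> 0.
Proof. intros H. specialize (H O). cbn in H. now rewrite Cmult_1_r in H. Qed.

(* The shift [A -> A q] with [b, c, d] fixed also multiplies the argument by [q]; iterated
   in [phi65_sum], it drives the series to its first term 1. *)
Lemma phi65_telescope (A b c d q : C) (N : nat) :
  q <> 0 -> b <> 0 -> c <> 0 -> d <> 0 ->
  den_wd q q -> den_wd q (A * q) ->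
  den_wd q (A * q / b) -> den_wd q (A * q / c) -> den_wd q (A * q / d) ->
  1 - A * q / (b * c * d) <> 0 ->
  Csum (phi65 A b c d q) (S N)
  = phi65_ratio A b c d q * Csum (phi65 (A * q) b c d q) (S N) + phi65_rest A b c d q N.
Proof.
  intros Hq0 Hb Hc Hd Wq WA Wb Wc Wd Hz.
  pose proof (den_wd_0 _ _ WA) as WA0. pose proof (den_wd_0 _ _ Wb) as Wb0.
  pose proof (den_wd_0 _ _ Wc) as Wc0. pose proof (den_wd_0 _ _ Wd) as Wd0.
  assert (Eb : A * q * q / b = A * q / b * q) by (field; auto).
  assert (Ec : A * q * q / c = A * q / c * q) by (field; auto).
  assert (Ed : A * q * q / d = A * q / d * q) by (field; auto).
  assert (Ez : A * q * q / (b * c * d) = A * q / (b * c * d) * q) by (field; auto).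
  induction N as [|N IH].
  - assert (Hs : forall A', Csum (phi65 A' b c d q) 1 = 1).
    { intros A'. unfold phi65. cbn. field. }
    rewrite !Hs. unfold phi65_ratio, phi65_rest.
    rewrite !poch_S, !poch_0. cbn [Cpow]. rewrite !Cmult_1_r, !Cmult_1_l.
    field. repeat split; auto.
    + apply (neq_0_scale (b * c * d) _ _) with (2 := Hz); [|field; auto].
      repeat apply Cmult_neq_0; auto.
    + apply (neq_0_scale d _ _ Hd Wd0). field; auto.
    + apply (neq_0_scale c _ _ Hc Wc0). field; auto.
    + apply (neq_0_scale b _ _ Hb Wb0). field; auto.
  - change (Csum (phi65 A b c d q) (S (S N)))
      with (Csum (phi65 A b c d q) (S N) + phi65 A b c d q (S N)).
    change (Csum (phi65 (A * q) b c d q) (S (S N)))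
      with (Csum (phi65 (A * q) b c d q) (S N) + phi65 (A * q) b c d q (S N)).
    rewrite IH.
    cut (phi65 A b c d q (S N) - phi65_ratio A b c d q * phi65 (A * q) b c d q (S N)
         = phi65_rest A b c d q (S N) - phi65_rest A b c d q N).
    { intros H. transitivity (phi65_ratio A b c d q * Csum (phi65 (A * q) b c d q) (S N)
        + phi65_ratio A b c d q * phi65 (A * q) b c d q (S N) + phi65_rest A b c d q N
        + (phi65 A b c d q (S N) - phi65_ratio A b c d q * phi65 (A * q) b c d q (S N))); [ring|].
      rewrite H. ring. }
    set (y := q ^ S N).
    assert (Hy : q ^ (2 * S N) = y ^ 2) by (unfold y; rewrite Nat.mul_comm; apply Cpow_mult_r).
    (* The common factor of all four terms; dividing by it leaves [phi65_core] at [y = q^(N+1)]. *)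
    set (K := poch (A * q) q N / poch q q (S N)
     * (poch b q (S N) * poch c q (S N) * poch d q (S N)
        / (poch (A * q / b) q (S N) * poch (A * q / c) q (S N) * poch (A * q / d) q (S N)))
     * (A * q / (b * c * d)) ^ S N).
    pose proof (Wb (S N)) as Wby. pose proof (Wc (S N)) as Wcy. pose proof (Wd (S N)) as Wdy.
    fold y in Wby, Wcy, Wdy.
    pose proof (poch_neq_0 _ _ (S N) Wb) as Pb. pose proof (poch_neq_0 _ _ (S N) Wc) as Pc.
    pose proof (poch_neq_0 _ _ (S N) Wd) as Pd. pose proof (poch_neq_0 _ _ (S N) Wq) as Pq.
    transitivity (K * ((1 - A * y ^ 2)
      - y * (1 - A * q * y ^ 2) * (1 - A * y)
      * ((1 - A * q / (b * c)) * (1 - A * q / (b * d)) * (1 - A * q / (c * d)))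
      / ((1 - A * q / b * y) * (1 - A * q / c * y) * (1 - A * q / d * y)
       * (1 - A * q / (b * c * d))))).
    + unfold K, phi65, phi65_ratio, vwp. rewrite Eb, Ec, Ed, Ez.
      rewrite !(poch_shift_div _ _ _ Wb0), !(poch_shift_div _ _ _ Wc0),
        !(poch_shift_div _ _ _ Wd0), !(poch_shift_div _ _ _ WA0).
      rewrite Hy, Cpow_mult_l. fold y.
      replace (A * q * q ^ N) with (A * y) by (unfold y; rewrite Cpow_S; ring).
      field. repeat split; auto.
      all: try (apply (neq_0_scale d _ _ Hd Wd0); field; auto; fail).
      all: try (apply (neq_0_scale c _ _ Hc Wc0); field; auto; fail).
      all: try (apply (neq_0_scale b _ _ Hb Wb0); field; auto; fail).
      all: try (apply (neq_0_scale d _ _ Hd Wdy); field; auto; fail).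
      all: try (apply (neq_0_scale c _ _ Hc Wcy); field; auto; fail).
      all: try (apply (neq_0_scale b _ _ Hb Wby); field; auto; fail).
      all: try (apply (neq_0_scale (b * c * d) _ _) with (2 := Hz); [|field; auto];
         repeat apply Cmult_neq_0; auto; fail).
    + rewrite phi65_core by auto. 
      unfold phi65_rest, K.
      rewrite (poch_S (A * q) q N), (poch_S q q N), (poch_S b q (S N)), (poch_S c q (S N)),
        (poch_S d q (S N)), (poch_S (A * q / b) q (S N)), (poch_S (A * q / c) q (S N)),
        (poch_S (A * q / d) q (S N)).
      replace (q ^ S (S N)) with (q * y) by (unfold y; now rewrite (Cpow_S q (S N))).
      rewrite (Cpow_S _ (S N)). fold y.
      replace (A * q * q ^ N) with (A * y) by (unfold y; rewrite Cpow_S; ring).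
      replace (q * q ^ N) with y by (unfold y; now rewrite Cpow_S).
      rewrite poch_S in Pq. replace (q * q ^ N) with y in Pq by (unfold y; now rewrite Cpow_S).
      assert (Pq1 : poch q q N <> 0) by (intros E; apply Pq; rewrite E; ring).
      assert (Pq2 : 1 - y <> 0) by (intros E; apply Pq; rewrite E; ring).
      field. repeat split; auto.
      all: try (apply (neq_0_scale d _ _ Hd Wdy); field; auto; fail).
      all: try (apply (neq_0_scale c _ _ Hc Wcy); field; auto; fail).
      all: try (apply (neq_0_scale b _ _ Hb Wby); field; auto; fail).
      all: try (apply (neq_0_scale (b * c * d) _ _) with (2 := Hz); [|field; auto];
         repeat apply Cmult_neq_0; auto; fail).
Qed.

(** * Total inversion, and uniform bounds for families of shifted factorials *)

Lemma Cinv_0 : / RtoC 0 = 0.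
Proof. unfold Cinv, RtoC. cbn. f_equal; unfold Rdiv; ring. Qed.

(** Unconditional thanks to [/ 0 = 0]; quotients can thus be regrouped by [ring] without side
    conditions. *)
Lemma Cinv_mult (x y : C) : / (x * y) = / x * / y.
Proof.
  destruct (Ceq_dec x 0) as [->|Hx]; [rewrite Cmult_0_l, Cinv_0; ring|].
  destruct (Ceq_dec y 0) as [->|Hy]; [rewrite Cmult_0_r, Cinv_0; ring|].
  field. auto.
Qed.

Lemma Cinv_inv (x : C) : / / x = x.
Proof.
  destruct (Ceq_dec x 0) as [->|Hx]; [now rewrite !Cinv_0|].
  field. auto.
Qed.

(** The index type is arbitrary so that families over several shifts are treated like sequences. *)
Definition Cbounded {I : Type} (u : I -> C) : Prop :=
  exists M, (0 < M)%R /\ forall i, (Cmod (u i) <= M)%R.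

Lemma Cbounded_const {I : Type} (c : C) : Cbounded (fun _ : I => c).
Proof.
  exists (Cmod c + 1)%R. pose proof (Cmod_ge_0 c). split; [|intros _]; lra.
Qed.

Lemma Cbounded_mult {I : Type} (u v : I -> C) :
  Cbounded u -> Cbounded v -> Cbounded (fun i => u i * v i).
Proof.
  intros [M [HM Hu]] [K [HK Hv]]. exists (M * K)%R. split; [nra|].
  intros i. rewrite Cmod_mult. apply Rmult_le_compat; auto using Cmod_ge_0.
Qed.

Lemma Cbounded_minus {I : Type} (u v : I -> C) :
  Cbounded u -> Cbounded v -> Cbounded (fun i => u i - v i).
Proof.
  intros [M [HM Hu]] [K [HK Hv]]. exists (M + K)%R. split; [lra|].
  intros i. unfold Cminus. eapply Rle_trans; [apply Cmod_triangle|]. rewrite Cmod_opp.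
  apply Rplus_le_compat; auto.
Qed.

Lemma Cbounded_ext {I : Type} (u v : I -> C) :
  (forall i, u i = v i) -> Cbounded u -> Cbounded v.
Proof. intros H [M [HM Hu]]. exists M. split; auto. intros i. now rewrite <- H. Qed.

Lemma Cbounded_pow {I : Type} (q : C) (n : I -> nat) :
  (Cmod q < 1)%R -> Cbounded (fun i => q ^ n i).
Proof.
  intros Hq. exists 1%R. split; [lra|]. intros i. rewrite Cmod_pow, <- (pow1 (n i)).
  apply pow_incr. split; [apply Cmod_ge_0 | lra].
Qed.

Lemma Cbounded_poch {I : Type} (x q : C) (k n : I -> nat) :
  (Cmod q < 1)%R -> Cbounded (fun i => poch (x * q ^ k i) q (n i)).
Proof.
  intros Hq. destruct (poch_upper x q Hq) as [M [HM H]]. exists M. split; auto.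
Qed.

Lemma Cbounded_inv_poch {I : Type} (x q : C) (k n : I -> nat) :
  (Cmod q < 1)%R -> den_wd q x -> Cbounded (fun i => / poch (x * q ^ k i) q (n i)).
Proof.
  intros Hq Hx. destruct (poch_lower x q Hq Hx) as [M [HM H]]. exists M. split; auto.
Qed.

Lemma Cbounded_poch_0 {I : Type} (x q : C) (n : I -> nat) :
  (Cmod q < 1)%R -> Cbounded (fun i => poch x q (n i)).
Proof.
  intros Hq. apply Cbounded_ext with (2 := Cbounded_poch x q (fun _ => O) n Hq).
  intros i. cbn [Cpow]. now rewrite Cmult_1_r.
Qed.

Lemma Cbounded_inv_poch_0 {I : Type} (x q : C) (n : I -> nat) :
  (Cmod q < 1)%R -> den_wd q x -> Cbounded (fun i => / poch x q (n i)).
Proof.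
  intros Hq Hx. apply Cbounded_ext with (2 := Cbounded_inv_poch x q (fun _ => O) n Hq Hx).
  intros i. cbn [Cpow]. now rewrite Cmult_1_r.
Qed.

Lemma Cbounded_vwp {I : Type} (A q : C) (k n : I -> nat) :
  (Cmod q < 1)%R -> Cbounded (fun i => vwp (A * q ^ k i) q (n i)).
Proof.
  intros Hq.
  (* With [pred], the successor case of [vwp] becomes a single product; the 1 added to its bound
     covers the value at [n = 0]. *)
  assert (H : Cbounded (fun i => (1 - A * q ^ (k i + 2 * n i))
                                 * poch (A * q * q ^ k i) q (pred (n i)))).
  { apply Cbounded_mult; [|now apply Cbounded_poch].
    apply Cbounded_minus; [apply Cbounded_const|].
    apply Cbounded_mult; [apply Cbounded_const | now apply (Cbounded_pow q)]. }
  destruct H as [M [HM H]]. exists (M + 1)%R. split; [lra|]. intros i.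
  destruct (n i) as [|m] eqn:E.
  - cbn [vwp]. rewrite Cmod_1. lra.
  - specialize (H i). rewrite E in H. cbn [pred] in H. unfold vwp.
    rewrite Cpow_add_r in H.
    replace (A * q ^ k i * q) with (A * q * q ^ k i) by ring. rewrite <- Cmult_assoc.
    eapply Rle_trans; [exact H | lra].
Qed.

Lemma Cbounded_vwp_0 {I : Type} (A q : C) (n : I -> nat) :
  (Cmod q < 1)%R -> Cbounded (fun i => vwp A q (n i)).
Proof.
  intros Hq. apply Cbounded_ext with (2 := Cbounded_vwp A q (fun _ => O) n Hq).
  intros i. cbn [Cpow]. now rewrite Cmult_1_r.
Qed.

(** Syntax-directed search. There is no rule for quotients: the goals given to it are written as
    products with inverse shifted factorials. *)
Ltac cbounded :=
  lazymatch goal with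
  | |- Cbounded (fun _ => ?c) => apply (Cbounded_const c)
  | |- Cbounded (fun n => @?u n * @?v n) => apply (Cbounded_mult u v); cbounded
  | |- Cbounded (fun n => @?u n - @?v n) => apply (Cbounded_minus u v); cbounded
  | |- Cbounded (fun n => ?q ^ @?k n) => apply (Cbounded_pow q k); assumption
  | |- Cbounded (fun n => poch (?x * ?q ^ @?k n) ?q (@?m n)) =>
      apply (Cbounded_poch x q k m); assumption
  | |- Cbounded (fun n => / poch (?x * ?q ^ @?k n) ?q (@?m n)) =>
      apply (Cbounded_inv_poch x q k m); assumption
  | |- Cbounded (fun n => poch ?x ?q (@?m n)) => apply (Cbounded_poch_0 x q m); assumption
  | |- Cbounded (fun n => / poch ?x ?q (@?m n)) =>
      apply (Cbounded_inv_poch_0 x q m); assumption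
  | |- Cbounded (fun n => vwp (?x * ?q ^ @?k n) ?q (@?m n)) =>
      apply (Cbounded_vwp x q k m); assumption
  | |- Cbounded (fun n => vwp ?x ?q (@?m n)) => apply (Cbounded_vwp_0 x q m); assumption
  end.

Lemma phi65_rest_cv (A b c d q : C) :
  (Cmod q < 1)%R -> den_wd q q ->
  den_wd q (A * q / b) -> den_wd q (A * q / c) -> den_wd q (A * q / d) ->
  (Cmod (A * q / (b * c * d)) < 1)%R ->
  Ccv (phi65_rest A b c d q) 0.
Proof.
  intros Hq Wq Wb Wc Wd Hz. set (z := A * q / (b * c * d)) in *.
  assert (H : Cbounded (fun n => poch (A * q) q n * / poch q q n
     * ((poch b q (S n) * poch c q (S n) * poch d q (S n))
        * (/ poch (A * q / b) q (S n) * / poch (A * q / c) q (S n) * / poch (A * q / d) q (S n)))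
     * ((1 - z * A * q ^ S n) * / (1 - z)))).
  { cbounded. }
  destruct H as [M [HM H]].
  apply Ccv_squeeze with (fun n => M * Cmod z * Cmod z ^ n)%R.
  - intros n. specialize (H n). set (u := _ * _) in H.
    replace (phi65_rest A b c d q n - 0) with (- (u * z ^ S n)).
    + rewrite Cmod_opp, Cmod_mult, Cmod_pow. simpl. rewrite Rmult_assoc.
      apply Rmult_le_compat_r; [|exact H].
      apply Rmult_le_pos; [apply Cmod_ge_0 | apply pow_le, Cmod_ge_0].
    + unfold u, phi65_rest, Cdiv. fold (A * q / (b * c * d)). fold z.
      rewrite !Cinv_mult. unfold Cdiv. ring.
  - replace 0%R with (M * Cmod z * 0)%R by ring.
    apply (is_lim_seq_scal_l _ _ (Finite 0)). apply is_lim_seq_geom.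
    rewrite Rabs_pos_eq; auto using Cmod_ge_0.
Qed.

(** The seven shifts are independent so that one bound serves both uses: the bases [A q^k] with
    fixed [b, c, d], and the inner sums, whose parameters move with [j] at different speeds. *)
Lemma phi65_family_bounded (A b c d e f g q : C) :
  (Cmod q < 1)%R -> den_wd q q -> den_wd q e -> den_wd q f -> den_wd q g ->
  exists M, (0 < M)%R /\ forall kA kb kc kd ke kf kg n,
    (Cmod (vwp (A * q ^ kA) q n / poch q q n
       * (poch (b * q ^ kb) q n * poch (c * q ^ kc) q n * poch (d * q ^ kd) q n
          / (poch (e * q ^ ke) q n * poch (f * q ^ kf) q n * poch (g * q ^ kg) q n)))
     <= M)%R.
Proof.
  intros Hq Wq We Wf Wg.
  assert (H : Cbounded (fun i : (nat * nat * nat * nat) * (nat * nat * nat) * nat =>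
    let '((kA, kb, kc, kd), (ke, kf, kg), n) := i in
    vwp (A * q ^ kA) q n * / poch q q n
       * (poch (b * q ^ kb) q n * poch (c * q ^ kc) q n * poch (d * q ^ kd) q n
          * (/ poch (e * q ^ ke) q n * / poch (f * q ^ kf) q n * / poch (g * q ^ kg) q n)))).
  (* The pattern-matching [let] is replaced by projections, a shape that [cbounded] recognises. *)
  { apply Cbounded_ext with (fun i : (nat * nat * nat * nat) * (nat * nat * nat) * nat =>
      vwp (A * q ^ (fst (fst (fst (fst (fst i)))))) q (snd i) * / poch q q (snd i)
       * (poch (b * q ^ (snd (fst (fst (fst (fst i)))))) q (snd i)
          * poch (c * q ^ (snd (fst (fst (fst i))))) q (snd i)
          * poch (d * q ^ (snd (fst (fst i)))) q (snd i)
          * (/ poch (e * q ^ (fst (fst (snd (fst i))))) q (snd i)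
             * / poch (f * q ^ (snd (fst (snd (fst i))))) q (snd i)
             * / poch (g * q ^ (snd (snd (fst i)))) q (snd i)))).
    - now intros [[[[[kA kb] kc] kd] [[ke kf] kg]] n].
    - cbounded. }
  destruct H as [M [HM H]]. exists M. split; auto.
  intros kA kb kc kd ke kf kg n. specialize (H (((kA, kb, kc, kd), (ke, kf, kg)), n)).
  cbv beta iota in H. unfold Cdiv. now rewrite !Cinv_mult.
Qed.

Lemma den_wd_small (q x : C) : (Cmod q < 1)%R -> (Cmod x < 1)%R -> den_wd q x.
Proof.
  intros Hq Hx i E. assert (E' : Cmod (x * q ^ i) = 1%R).
  { replace (x * q ^ i) with (1 - (1 - x * q ^ i)) by ring.
    rewrite E. replace (1 - 0) with (RtoC 1) by ring. apply Cmod_1. }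
  rewrite Cmod_mult, Cmod_pow in E'. pose proof (Cmod_ge_0 q).
  assert (Hp : (0 <= Cmod q ^ i <= 1)%R).
  { split; [apply pow_le; lra|]. rewrite <- (pow1 i). apply pow_incr. lra. }
  pose proof (Cmod_ge_0 x). nra.
Qed.

(** With [S' k] the sum for base [A q^k], the relation [S' k = phi65_ratio * S' (S k)] and the limit
    [S' k -> 1] give [S' 0] as the infinite product of the ratios. *)
Lemma phi65_sum (A b c d q : C) :
  (0 < Cmod q < 1)%R -> b <> 0 -> c <> 0 -> d <> 0 ->
  den_wd q q -> den_wd q (A * q) ->
  den_wd q (A * q / b) -> den_wd q (A * q / c) -> den_wd q (A * q / d) ->
  (Cmod (A * q / (b * c * d)) < 1)%R ->
  Ccv_series (phi65 A b c d q)
    (qpoch_inf (A * q) q * qpoch_inf (A * q / (b * c)) q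
     * qpoch_inf (A * q / (b * d)) q * qpoch_inf (A * q / (c * d)) q
     / (qpoch_inf (A * q / b) q * qpoch_inf (A * q / c) q
        * qpoch_inf (A * q / d) q * qpoch_inf (A * q / (b * c * d)) q)).
Proof.
  intros [Hq0' Hq] Hb Hc Hd Wq WA Wb Wc Wd Hz.
  assert (Hq0 : q <> 0) by now apply Cmod_gt_0.
  assert (Wz : den_wd q (A * q / (b * c * d))).
  { apply den_wd_small; lra. }
  assert (Sh : forall k x, A * q ^ k * q / x = A * q / x * q ^ k) by (intros; unfold Cdiv; ring).
  assert (ShA : forall k, A * q ^ k * q = A * q * q ^ k) by (intros; ring).
  set (t := fun k => phi65 (A * q ^ k) b c d q).
  set (z := A * q / (b * c * d)) in *.
  pose proof (Cmod_ge_0 z) as Hz0.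
  assert (Hbd : exists M, (0 < M)%R /\ forall k n, (Cmod (t k n) <= M * (Cmod z * Cmod q ^ k) ^ n)%R).
  { destruct (phi65_family_bounded A b c d _ _ _ q Hq Wq Wb Wc Wd) as [M [HM H]].
    exists M. split; auto. intros k n.
    specialize (H k O O O k k k n). cbn [Cpow] in H. rewrite !Cmult_1_r in H.
    unfold t, phi65. rewrite !Sh. fold z. rewrite (Cmod_mult _ ((z * q ^ k) ^ n)).
    rewrite (Cmod_pow (z * q ^ k) n), (Cmod_mult z), (Cmod_pow q k).
    apply Rmult_le_compat_r; [|exact H].
    apply pow_le, Rmult_le_pos; auto. apply pow_le; lra. }
  destruct Hbd as [M [HM Hbd]].
  assert (Hr : forall k, (0 <= Cmod z * Cmod q ^ k <= Cmod z)%R).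
  { intros k. assert (Hp : (0 <= Cmod q ^ k <= 1)%R).
    { split; [apply pow_le; lra|]. rewrite <- (pow1 k). apply pow_incr. lra. }
    nra. }
  set (S' := fun k => CSeries (t k)).
  assert (HS : forall k, Ccv_series (t k) (S' k)).
  { intros k. destruct (Ccv_series_geom (t k) M (Cmod z * Cmod q ^ k)) as [l Hl].
    - specialize (Hr k). lra.
    - apply Hbd.
    - unfold S'. now rewrite (CSeries_unique _ _ Hl). }
  assert (Hstep : forall k, S' k = phi65_ratio (A * q ^ k) b c d q * S' (S k)).
  { intros k. apply Ccv_unique with (fun n => Csum (t k) (n + 1)).
    - apply Ccv_incr, HS.
    - replace (phi65_ratio (A * q ^ k) b c d q * S' (S k))
        with (phi65_ratio (A * q ^ k) b c d q * S' (S k) + 0) by ring.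
      apply Ccv_ext with (fun n => phi65_ratio (A * q ^ k) b c d q * Csum (t (S k)) (n + 1)
                                   + phi65_rest (A * q ^ k) b c d q n).
      + intros n. rewrite Nat.add_1_r. symmetry. unfold t.
        replace (A * q ^ S k) with (A * q ^ k * q) by (rewrite Cpow_S; ring).
        apply phi65_telescope; auto; rewrite ?Sh, ?ShA; try now apply den_wd_shift.
        apply Wz.
      + apply Ccv_plus; [apply Ccv_scal, Ccv_incr, HS|].
        apply phi65_rest_cv; auto; rewrite ?Sh; try now apply den_wd_shift.
        fold z. rewrite Cmod_mult, Cmod_pow. specialize (Hr k). lra. }
  set (N' := fun k => poch (A * q) q k * poch (A * q / (b * c)) q k
     * poch (A * q / (b * d)) q k * poch (A * q / (c * d)) q k).
  set (D' := fun k => poch (A * q / b) q k * poch (A * q / c) q k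
        * poch (A * q / d) q k * poch z q k).
  (* Cross-multiplied, since numerators such as [1 - A q^(k+1) / (b c)] may vanish; only denominator
     factors are cancelled. *)
  assert (Hprod : forall k, N' k * S' k = S' O * D' k).
  { induction k as [|k IH].
    - unfold N', D'. rewrite !poch_0. ring.
    - rewrite Hstep in IH. unfold phi65_ratio in IH. rewrite !Sh, ShA in IH. fold z in IH.
      unfold N', D' in *. rewrite !poch_S.
      pose proof (Wb k). pose proof (Wc k). pose proof (Wd k). pose proof (Wz k).
      transitivity (S' O * (poch (A * q / b) q k * poch (A * q / c) q k
         * poch (A * q / d) q k * poch z q k) * ((1 - A * q / b * q ^ k)
         * (1 - A * q / c * q ^ k) * (1 - A * q / d * q ^ k) * (1 - z * q ^ k))); [|ring].
      rewrite <- IH. clear IH.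
      set (e := A * q / b) in *. set (f := A * q / c) in *. set (g := A * q / d) in *.
      clearbody e f g z. field. repeat split; auto. }
  (* The term of index 0 is 1; the tail from index 1 is [O(|z| |q|^k)] because the argument for base
     [A q^k] is [z q^k]. *)
  assert (HS1 : Ccv S' 1).
  { apply Ccv_squeeze with (fun k => M * Cmod z / (1 - Cmod z) * Cmod q ^ k)%R.
    - intros k. replace (RtoC 1) with (Csum (t k) 1).
      2:{ unfold t, phi65. cbn. field. }
      pose proof (Hr k) as Hrk.
      eapply Rle_trans.
      + apply (Ccv_series_tail_bound (t k) (S' k) M (Cmod z * Cmod q ^ k) 1); auto; lra.
      + rewrite pow_1. unfold Rdiv.
        replace (M * Cmod z * / (1 - Cmod z) * Cmod q ^ k)%R
          with (M * (Cmod z * Cmod q ^ k) * / (1 - Cmod z))%R by ring.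
        apply Rmult_le_compat_l; [apply Rmult_le_pos; lra|].
        apply Rinv_le_contravar; lra.
    - replace 0%R with (M * Cmod z / (1 - Cmod z) * 0)%R by ring.
      apply (is_lim_seq_scal_l _ _ (Finite 0)). apply is_lim_seq_geom.
      rewrite Rabs_pos_eq; lra. }
  assert (HN : Ccv (fun k => N' k * S' k) (qpoch_inf (A * q) q * qpoch_inf (A * q / (b * c)) q
     * qpoch_inf (A * q / (b * d)) q * qpoch_inf (A * q / (c * d)) q * 1)).
  { apply Ccv_mult; auto. unfold N'. repeat apply Ccv_mult; now apply qpoch_inf_cv. }
  assert (HD : Ccv (fun k => N' k * S' k) (S' O * (qpoch_inf (A * q / b) q * qpoch_inf (A * q / c) q
        * qpoch_inf (A * q / d) q * qpoch_inf z q))).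
  { apply Ccv_ext with (fun k => S' O * D' k); [intros; symmetry; apply Hprod|].
    apply Ccv_scal. unfold D'. repeat apply Ccv_mult; now apply qpoch_inf_cv. }
  pose proof (Ccv_unique _ _ _ HN HD) as E.
  pose proof (HS O) as HS0. unfold t in HS0. cbn [Cpow] in HS0. rewrite Cmult_1_r in HS0.
  rewrite Cmult_1_r in E. rewrite E.
  replace (S' O * _ / _) with (S' O); [exact HS0|].
  field. repeat split; now apply qpoch_inf_neq_0.
Qed.

(** * Jackson's terminating 8phi7 sum *)

(** What [jackson_step] becomes after removal of the common factor, with [y = q^j], [u = q^(n-j)],
    hence [u y = q^n]. The balancing condition enters as the value of [d]. *)
Lemma jackson_core (q a p b c d u y : C) :
  a <> 0 -> b <> 0 -> c <> 0 -> p <> 0 ->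
  d = q * p ^ 2 / (a * b * c) -> d <> 0 ->
  (1 - a * y ^ 2)
  * ((1 - p * (u * y) * y) * (1 - q * (u * y)) * (1 - p / a * u)
     * ((1 - p * q / b * (u * y)) * (1 - p * q / c * (u * y)) * (1 - p * q / d * (u * y)))
     - (1 - b * (u * y)) * (1 - c * (u * y)) * (1 - d * (u * y))
       * (1 - p * (u * y)) * (1 - q * u) * (1 - a * q * (u * y) * y))
  = - u * (1 - p * q * (u * y) ^ 2)
    * (p / a * (1 - a * y) * (1 - a * b / p * y) * (1 - a * c / p * y) * (1 - a * d / p * y)
       * (1 - p * (u * y) * y) * (1 - q * u)
       - q * (1 - y) * (1 - p * y / b) * (1 - p * y / c) * (1 - p * y / d)
         * (1 - a * q * (u * y) * y) * (1 - p / a * u)).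
Proof.
  intros Ha Hb Hc Hp Hd Hd0.
  assert (Hq : q <> 0).
  { intros E. apply Hd0. rewrite Hd, E. field. auto. }
  rewrite Hd. field. repeat split; auto.
Qed.

(** The case [j = 0], with [x = q^n]: [jackson_core] at [y = 1], [u = x], divided by
    [(1 - a) (1 - p x) (1 - q x)]. It is proved separately because these factors may vanish. *)
Lemma jackson_core_0 (q a p b c d x : C) :
  a <> 0 -> b <> 0 -> c <> 0 -> p <> 0 ->
  d = q * p ^ 2 / (a * b * c) -> d <> 0 ->
  (1 - p / a * x)
  * ((1 - p * q / b * x) * (1 - p * q / c * x) * (1 - p * q / d * x))
  - (1 - b * x) * (1 - c * x) * (1 - d * x) * (1 - a * q * x)
  = - x * (1 - p * q * x ^ 2)
    * (p / a * (1 - a * b / p) * (1 - a * c / p) * (1 - a * d / p)).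
Proof.
  intros Ha Hb Hc Hp Hd Hd0.
  assert (Hq : q <> 0).
  { intros E. apply Hd0. rewrite Hd, E. field. auto. }
  rewrite Hd. field. repeat split; auto.
Qed.

(* The summand of the 8phi7 with base [a] and numerators [ab/p, ac/p, ad/p, p q^n, q^(-n)],
   multiplied by [(p/a;q)_n / (aq;q)_n]: the factors depending on [n - j] are regrouped so that
   nothing is divided by [(p/a;q)_n], which vanishes when [a = p q^i] with [i < n]. *)
Definition jackson (q a p b c d : C) (n j : nat) : C :=
  vwp a q j
  * (poch (a * b / p) q j * poch (a * c / p) q j * poch (a * d / p) q j)
  / (poch q q j * (poch (p * q / b) q j * poch (p * q / c) q j * poch (p * q / d) q j))
  * (p / a) ^ j * poch (p * q ^ n) q j
  * (poch q q n / poch q q (n - j)) * poch (p / a) q (n - j) / poch (a * q) q (n + j).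

(* The Wilf-Zeilberger companion of [jackson] for the recurrence in [n]. *)
Definition jackson_cert (q a p b c d : C) (n j : nat) : C :=
  match j with
  | O => 0
  | S i =>
      - (poch (a * q) q i
         * (poch (a * b / p) q j * poch (a * c / p) q j * poch (a * d / p) q j)
         / (poch q q i * (poch (p * q / b) q i * poch (p * q / c) q i * poch (p * q / d) q i))
         * (p / a) ^ j * poch (p * q ^ S n) q i
         * (poch q q n / poch q q (n - i)) * poch (p / a) q (n - i)
         / poch (a * q) q (S n + i)
         * q ^ (n - i) * (1 - p * q * (q ^ n) ^ 2)
         / ((1 - p * q / b * q ^ n) * (1 - p * q / c * q ^ n) * (1 - p * q / d * q ^ n)))
  end.

(** Quotient of the right sides of Jackson's sum at [n + 1] and [n]. *)
Definition jackson_ratio (q p b c d : C) (n : nat) : C :=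
  (1 - b * q ^ n) * (1 - c * q ^ n) * (1 - d * q ^ n)
  / ((1 - p * q / b * q ^ n) * (1 - p * q / c * q ^ n) * (1 - p * q / d * q ^ n)).

Lemma jackson_step (q a p b c d : C) (n j : nat) :
  q <> 0 -> a <> 0 -> b <> 0 -> c <> 0 -> p <> 0 -> d <> 0 -> a * b * c * d = q * p ^ 2 ->
  den_wd q q -> den_wd q (a * q) ->
  den_wd q (p * q / b) -> den_wd q (p * q / c) -> den_wd q (p * q / d) ->
  (j <= n)%nat ->
  jackson q a p b c d (S n) j - jackson_ratio q p b c d n * jackson q a p b c d n j
  = jackson_cert q a p b c d n (S j) - jackson_cert q a p b c d n j.
Proof.
  intros Hq Ha Hb Hc Hp Hd H Wq Wa Wb Wc Wd Hj.
  assert (Ed : d = q * p ^ 2 / (a * b * c)).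
  { rewrite <- H. field. auto. }
  pose proof (Wb n) as Wbn. pose proof (Wc n) as Wcn. pose proof (Wd n) as Wdn.
  pose proof (fun k => poch_neq_0 _ _ k Wq) as Pq.
  pose proof (fun k => poch_neq_0 _ _ k Wa) as Pa.
  pose proof (fun k => poch_neq_0 _ _ k Wb) as Pb.
  pose proof (fun k => poch_neq_0 _ _ k Wc) as Pc.
  pose proof (fun k => poch_neq_0 _ _ k Wd) as Pd.
  destruct j as [|i].
  - pose proof (jackson_core_0 q a p b c d (q ^ n) Ha Hb Hc Hp Ed Hd) as Hcore.
    unfold jackson, jackson_cert, jackson_ratio. rewrite !Nat.sub_0_r, !Nat.add_0_r.
    rewrite !poch_0, !(poch_S _ _ 0), !poch_0. cbn [vwp Cpow].
    rewrite !poch_S. pose proof (Wa n). pose proof (Pa n). pose proof (Pq n). pose proof (Wq n).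
    set (e := p * q / b) in *. set (f := p * q / c) in *. set (g := p * q / d) in *.
    set (x := q ^ n) in *.
    transitivity (poch (p / a) q n / (poch (a * q) q n * (1 - a * q * x)
        * ((1 - e * x) * (1 - f * x) * (1 - g * x)))
      * ((1 - p / a * x) * ((1 - e * x) * (1 - f * x) * (1 - g * x))
         - (1 - b * x) * (1 - c * x) * (1 - d * x) * (1 - a * q * x))).
    + clear Hcore. clearbody e f g x. field. repeat split; auto.
    + rewrite Hcore. clear Hcore. clearbody e f g x. field. repeat split; auto.
  (* Writing [n = m + j] removes every truncated subtraction. *)
  - destruct (Nat.le_exists_sub _ _ Hj) as [m [-> _]].
    replace (m + S i - S i)%nat with m by lia.
    replace (m + S i - i)%nat with (S m) by lia.
    set (n := (m + S i)%nat) in *.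
    set (u := q ^ m). set (y := q ^ S i).
    assert (Hx : q ^ n = u * y) by (unfold n, u, y; apply Cpow_add_r).
    pose proof (jackson_core q a p b c d u y Ha Hb Hc Hp Ed Hd) as Hcore.
    rewrite Hx in Wbn, Wcn, Wdn.
    (* Common factor of the four terms, computed in [E1] to [E4]; what is left is [jackson_core]
       divided by [Del]. *)
    pose (K := poch (a * q) q i
      * (poch (a * b / p) q (S i) * poch (a * c / p) q (S i) * poch (a * d / p) q (S i))
      / (poch q q (S i) * (poch (p * q / b) q (S i) * poch (p * q / c) q (S i) * poch (p * q / d) q (S i)))
      * (p / a) ^ S i * poch (p * q ^ S n) q i
      * (poch q q n / poch q q (S m)) * poch (p / a) q m / poch (a * q) q (S n + S i)).
    pose (Del := (1 - p * q / b * (u * y)) * (1 - p * q / c * (u * y)) * (1 - p * q / d * (u * y))).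
    assert (HDel : Del <> 0) by (unfold Del; repeat apply Cmult_neq_0; auto).
    assert (Hy2 : q ^ (2 * S i) = y ^ 2) by (unfold y; rewrite Nat.mul_comm; apply Cpow_mult_r).
    assert (Hxq1 : q * q ^ n = q * (u * y)) by now rewrite Hx.
    assert (Hxi : p * q ^ S n * q ^ i = p * (u * y) * y).
    { unfold y. rewrite !Cpow_S, Hx. unfold y. rewrite Cpow_S. ring. }
    assert (Hyi : a * q * q ^ i = a * y) by (unfold y; rewrite Cpow_S; ring).
    assert (Hxi2 : a * q * q ^ (n + S i) = a * q * (u * y * y)).
    { rewrite Cpow_add_r, Hx. reflexivity. }
    assert (Hqi : forall z, p * q / z * q ^ i = p * y / z).
    { intros z. unfold y, Cdiv. rewrite Cpow_S. ring. }
    assert (E1 : jackson q a p b c d (S n) (S i)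
      = K * ((1 - a * y ^ 2) * (1 - p * (u * y) * y) * (1 - q * (u * y)) * (1 - p / a * u))).
    { unfold jackson, K. replace (S n - S i)%nat with (S m) by lia.
      rewrite (poch_S (p * q ^ S n) q i), (poch_S q q n), (poch_S (p / a) q m). fold u.
      rewrite Hxq1, Hxi. cbn [vwp]. rewrite Hy2.
      pose proof (Pq (S m)). pose proof (Pq (S i)). pose proof (Pb (S i)). pose proof (Pc (S i)).
      pose proof (Pd (S i)). pose proof (Pa (S n + S i)%nat).
      field. repeat split; auto. }
    assert (E2 : jackson q a p b c d n (S i)
      = K * ((1 - a * y ^ 2) * (1 - p * (u * y)) * (1 - q * u) * (1 - a * q * (u * y) * y))).
    { unfold jackson, K. replace (n - S i)%nat with m by (unfold n; lia).
      rewrite (poch_S_l (p * q ^ n) q i), Hx.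
      replace (p * (u * y) * q) with (p * q ^ S n) by (rewrite Cpow_S, Hx; ring).
      change (S n + S i)%nat with (S (n + S i)).
      pose proof (Pq (S m)) as Pqm. pose proof (Pa (S (n + S i))) as Pan.
      rewrite poch_S in Pqm, Pan. fold u in Pqm. rewrite (poch_S q q m), (poch_S (a * q) q (n + S i)).
      fold u. rewrite Hxi2 in *. cbn [vwp]. rewrite Hy2.
      pose proof (Pq m). pose proof (Pq (S i)). pose proof (Pb (S i)). pose proof (Pc (S i)).
      pose proof (Pd (S i)). pose proof (Pa (n + S i)%nat).
      assert (1 - q * u <> 0) by (intros E; apply Pqm; rewrite E; ring).
      assert (1 - a * q * (u * y * y) <> 0) by (intros E; apply Pan; rewrite E; ring).
      field. repeat split; auto. }
    assert (E3 : jackson_cert q a p b c d n (S (S i))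
      = K * (- u * (1 - p * q * (u * y) ^ 2) *
        (p / a * (1 - a * y) * (1 - a * b / p * y) * (1 - a * c / p * y) * (1 - a * d / p * y)
       * (1 - p * (u * y) * y) * (1 - q * u))) / Del).
    { unfold jackson_cert, K. replace (n - S i)%nat with m by (unfold n; lia).
      rewrite (poch_S (a * b / p) q (S i)), (poch_S (a * c / p) q (S i)),
        (poch_S (a * d / p) q (S i)), (poch_S (a * q) q i), (poch_S (p * q ^ S n) q i).
      pose proof (Pq (S m)) as Pqm. rewrite poch_S in Pqm. fold u in Pqm.
      rewrite (poch_S q q m). fold u y. rewrite Hxi, Hx, Hyi. fold Del.
      rewrite (Cpow_S (p / a) (S i)).
      pose proof (Pq m). pose proof (Pq (S i)). pose proof (Pb (S i)). pose proof (Pc (S i)).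
      pose proof (Pd (S i)). pose proof (Pa (S n + S i)%nat).
      assert (1 - q * u <> 0) by (intros E; apply Pqm; rewrite E; ring).
      clearbody Del. field. repeat split; auto. }
    assert (E4 : jackson_cert q a p b c d n (S i)
      = K * (- u * (1 - p * q * (u * y) ^ 2) *
        (q * (1 - y) * (1 - p * y / b) * (1 - p * y / c) * (1 - p * y / d)
         * (1 - a * q * (u * y) * y) * (1 - p / a * u))) / Del).
    { unfold jackson_cert, K. replace (n - i)%nat with (S m) by (unfold n; lia).
      replace (S n + S i)%nat with (S (S n + i)) by lia.
      pose proof (Pq (S i)) as Pqi. pose proof (Pb (S i)) as Pbi.
      pose proof (Pc (S i)) as Pci. pose proof (Pd (S i)) as Pdi.
      pose proof (Pa (S (S n + i))) as Pan.
      rewrite poch_S in Pqi, Pbi, Pci, Pdi, Pan.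
      rewrite (poch_S q q i), (poch_S (p * q / b) q i), (poch_S (p * q / c) q i),
        (poch_S (p * q / d) q i), (poch_S (a * q) q (S n + i)), (poch_S (p / a) q m).
      replace (S n + i)%nat with (n + S i)%nat in * by lia. rewrite Hxi2 in *.
      rewrite !Hqi in *. rewrite Hx. fold Del. rewrite (Cpow_S q m). fold u.
      replace (q * q ^ i) with y in * by (unfold y; now rewrite Cpow_S).
      pose proof (Pq (S m)). pose proof (Pq i). pose proof (Pb i). pose proof (Pc i).
      pose proof (Pd i). pose proof (Pa (n + S i)%nat).
      assert (N1 : 1 - y <> 0) by (intros E; apply Pqi; rewrite E; ring).
      assert (N2 : 1 - p * y / b <> 0) by (intros E; apply Pbi; rewrite E; ring).
      assert (N3 : 1 - p * y / c <> 0) by (intros E; apply Pci; rewrite E; ring).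
      assert (N4 : 1 - p * y / d <> 0) by (intros E; apply Pdi; rewrite E; ring).
      assert (N5 : 1 - a * q * (u * y * y) <> 0) by (intros E; apply Pan; rewrite E; ring).
      clearbody Del. field. repeat split; auto.
      - apply (neq_0_scale d _ _ Hd N4). field; auto.
      - apply (neq_0_scale c _ _ Hc N3). field; auto.
      - apply (neq_0_scale b _ _ Hb N2). field; auto. }
    rewrite E1, E2, E3, E4. unfold jackson_ratio. rewrite Hx.
    change ((1 - p * q / b * (u * y)) * (1 - p * q / c * (u * y)) * (1 - p * q / d * (u * y))) with Del.
    set (L := (1 - a * y ^ 2) * _) in Hcore.
    transitivity (K / Del * L).
    + unfold L. fold Del. clearbody K Del. field. repeat split; auto.
    + rewrite Hcore. clearbody K Del. field. repeat split; auto.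
Qed.

(** The boundary case [j = n + 1]. There the summand of index [n] ought to be 0, but truncated
    subtraction gives [jackson n (S n)] another value, so [jackson_step] stops at [j = n] and the
    last new term is matched with the certificate directly. *)
Lemma jackson_last (q a p b c d : C) (n : nat) :
  q <> 0 -> a <> 0 -> b <> 0 -> c <> 0 -> p <> 0 -> d <> 0 -> a * b * c * d = q * p ^ 2 ->
  den_wd q q -> den_wd q (a * q) ->
  den_wd q (p * q / b) -> den_wd q (p * q / c) -> den_wd q (p * q / d) ->
  jackson q a p b c d (S n) (S n) = - jackson_cert q a p b c d n (S n).
Proof.
  intros Hq Ha Hb Hc Hp Hd H Wq Wa Wb Wc Wd.
  pose proof (fun k => poch_neq_0 _ _ k Wq) as Pq.
  pose proof (fun k => poch_neq_0 _ _ k Wa) as Pa.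
  pose proof (fun k => poch_neq_0 _ _ k Wb) as Pb.
  pose proof (fun k => poch_neq_0 _ _ k Wc) as Pc.
  pose proof (fun k => poch_neq_0 _ _ k Wd) as Pd.
  unfold jackson, jackson_cert. rewrite !Nat.sub_diag, !poch_0.
  pose proof (Pq (S n)) as Pqn. pose proof (Pb (S n)) as Pbn.
  pose proof (Pc (S n)) as Pcn. pose proof (Pd (S n)) as Pdn.
  pose proof (Pa (S n + S n)%nat) as Pan.
  replace (S n + S n)%nat with (S (S n + n)) in * by lia.
  rewrite poch_S in Pqn, Pbn, Pcn, Pdn, Pan.
  rewrite (poch_S q q n), (poch_S (p * q / b) q n), (poch_S (p * q / c) q n),
    (poch_S (p * q / d) q n), (poch_S (a * q) q (S n + n)), (poch_S (p * q ^ S n) q n).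
  cbn [vwp]. set (x := q ^ n) in *.
  assert (H1 : q ^ (2 * S n) = (q * x) ^ 2).
  { rewrite Nat.mul_comm, Cpow_mult_r. unfold x. now rewrite Cpow_S. }
  assert (H2 : a * q * q ^ (S n + n) = a * (q * x) ^ 2).
  { rewrite Cpow_add_r, Cpow_S. fold x. ring. }
  assert (H3 : p * q ^ S n * x = p * q * x ^ 2) by (rewrite Cpow_S; fold x; ring).
  rewrite H1, H2, H3. rewrite H2 in Pan.
  pose proof (Pq n). pose proof (Pb n). pose proof (Pc n). pose proof (Pd n).
  pose proof (Pa (S n + n)%nat).
  assert (N1 : 1 - q * x <> 0) by (intros E; apply Pqn; rewrite E; ring).
  assert (N2 : 1 - p * q / b * x <> 0) by (intros E; apply Pbn; rewrite E; ring).
  assert (N3 : 1 - p * q / c * x <> 0) by (intros E; apply Pcn; rewrite E; ring).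
  assert (N4 : 1 - p * q / d * x <> 0) by (intros E; apply Pdn; rewrite E; ring).
  assert (N5 : 1 - a * (q * x) ^ 2 <> 0) by (intros E; apply Pan; rewrite E; ring).
  set (e := p * q / b) in *. set (f := p * q / c) in *. set (g := p * q / d) in *.
  clearbody e f g x. cbn [Cpow].
  field. repeat split; auto.
  all: cbn [Cpow] in N5; rewrite ?Cmult_1_r in N5; intros E; apply N5; rewrite <- E; ring.
Qed.

Lemma jackson_telescope (q a p b c d : C) (n k : nat) :
  q <> 0 -> a <> 0 -> b <> 0 -> c <> 0 -> p <> 0 -> d <> 0 -> a * b * c * d = q * p ^ 2 ->
  den_wd q q -> den_wd q (a * q) ->
  den_wd q (p * q / b) -> den_wd q (p * q / c) -> den_wd q (p * q / d) ->
  (k <= S n)%nat ->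
  Csum (jackson q a p b c d (S n)) k
  = jackson_ratio q p b c d n * Csum (jackson q a p b c d n) k + jackson_cert q a p b c d n k.
Proof.
  intros Hq Ha Hb Hc Hp Hd H Wq Wa Wb Wc Wd. induction k as [|k IH]; intros Hk.
  - cbn. ring.
  - cbn [Csum]. rewrite IH by lia.
    pose proof (jackson_step q a p b c d n k Hq Ha Hb Hc Hp Hd H Wq Wa Wb Wc Wd) as Hs.
    specialize (Hs ltac:(lia)).
    set (h := jackson_cert q a p b c d n (S k)) in *.
    replace h with (h - jackson_cert q a p b c d n k + jackson_cert q a p b c d n k) by ring.
    rewrite <- Hs. ring.
Qed.

(** Induction on [n]: the certificate is 0 at [j = 0] and cancels the new last term at [j = n + 1],
    so the sum is multiplied by exactly [jackson_ratio]. *)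
Lemma jackson_sum (q a p b c d : C) (n : nat) :
  q <> 0 -> a <> 0 -> b <> 0 -> c <> 0 -> p <> 0 -> d <> 0 -> a * b * c * d = q * p ^ 2 ->
  den_wd q q -> den_wd q (a * q) ->
  den_wd q (p * q / b) -> den_wd q (p * q / c) -> den_wd q (p * q / d) ->
  Csum (jackson q a p b c d n) (S n)
  = poch b q n * poch c q n * poch d q n
    / (poch (p * q / b) q n * poch (p * q / c) q n * poch (p * q / d) q n).
Proof.
  intros Hq Ha Hb Hc Hp Hd H Wq Wa Wb Wc Wd. induction n as [|n IH].
  - unfold jackson. cbn. field.
  - change (Csum (jackson q a p b c d (S n)) (S (S n)))
      with (Csum (jackson q a p b c d (S n)) (S n) + jackson q a p b c d (S n) (S n)).
    rewrite jackson_last, jackson_telescope, IH by auto.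
    unfold jackson_ratio. rewrite !poch_S.
    pose proof (Wb n). pose proof (Wc n). pose proof (Wd n).
    pose proof (poch_neq_0 _ _ n Wb). pose proof (poch_neq_0 _ _ n Wc).
    pose proof (poch_neq_0 _ _ n Wd).
    set (e := p * q / b) in *. set (f := p * q / c) in *. set (g := p * q / d) in *.
    set (h := jackson_cert _ _ _ _ _ _ _ _). clearbody e f g h.
    field. repeat split; auto.
Qed.

(** * Interchange of summations *)

(** For [j + m > 0] both sides equal [(1 - p q^(2(j+m))) (pq;q)_(2j+m-1)]. This is how base [p] at
    index [j + m] turns into base [p q^(2j)] at index [m]. *)
Lemma vwp_split (p q : C) (j m : nat) :
  vwp p q (j + m) * poch (p * q ^ (j + m)) q j
  = poch (p * q) q (2 * j) * vwp (p * q ^ (2 * j)) q m.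
Proof.
  destruct j as [|i].
  - rewrite Nat.mul_0_r, !poch_0. cbn [Cpow Nat.add]. rewrite !Cmult_1_r. ring.
  - assert (H : vwp p q (S i + m) * poch (p * q ^ (S i + m)) q (S i)
      = (1 - p * q ^ (2 * (S i + m))) * poch (p * q) q (i + m + S i)).
    { rewrite poch_add. change (S i + m)%nat with (S (i + m)). cbn [vwp].
      replace (p * q ^ S (i + m)) with (p * q * q ^ (i + m)) by (rewrite Cpow_S; ring). ring. }
    rewrite H. destruct m as [|k].
    + replace (2 * S i)%nat with (S (i + 0 + S i)) by lia. rewrite poch_S.
      replace (2 * (S i + 0))%nat with (S (i + 0 + S i)) by lia. rewrite Cpow_S. cbn [vwp]. ring.
    + cbn [vwp]. replace (i + S k + S i)%nat with (2 * S i + k)%nat by lia.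
      rewrite poch_add. replace (2 * (S i + S k))%nat with (2 * S i + 2 * S k)%nat by lia.
      rewrite Cpow_add_r.
      replace (p * q ^ (2 * S i) * q) with (p * q * q ^ (2 * S i)) by ring. ring.
Qed.

(* For [a <> 1] this is [(s,-s)_j / (sq,-sq)_j = (1 - a) / (1 - a q^(2j))], which turns
   the very-well-poised factor of the outer sum into [(a;q)_j]. *)
Lemma vwp_sqr (s a q : C) (j : nat) :
  s ^ 2 = a ->
  vwp a q j * (poch s q j * poch (- s) q j)
  = poch a q j * (poch (s * q) q j * poch (- s * q) q j).
Proof.
  intros Hs. destruct j as [|i]; [cbn; ring|].
  rewrite (poch_S_l s), (poch_S_l (- s)), (poch_S_l a), (poch_S (s * q)), (poch_S (- s * q)).
  cbn [vwp]. replace (2 * S i)%nat with (S i * 2)%nat by lia.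
  rewrite Cpow_mult_r, (Cpow_S q i), <- Hs. ring.
Qed.

(** * Expansion of the folded series for general [p] *)

Section Transform.

Context (q a p b c d s : C).
Context (Hq : (0 < Cmod q < 1)%R) (Hsa : s ^ 2 = a) (Hs : s <> 0)
  (Hb : b <> 0) (Hc : c <> 0) (Hd : d <> 0) (Hp : p <> 0)
  (Habcd : a * b * c * d = q * p ^ 2) (Hz : (Cmod (p * q / a) < 1)%R)
  (Wq : den_wd q q) (Wa : den_wd q (a * q)) (Wp : den_wd q (p * q))
  (Ws : den_wd q (p * q / s)) (Ws' : den_wd q (- (p * q / s)))
  (Wb : den_wd q (p * q / b)) (Wc : den_wd q (p * q / c)) (Wd : den_wd q (p * q / d)).

(** The part of the double summand that depends on [j] alone once [n = j + m]; the rest is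
    [bailey_inner j m]. *)
Definition bailey_coef (j : nat) : C :=
  vwp a q j
  * (poch (a * b / p) q j * poch (a * c / p) q j * poch (a * d / p) q j)
  / (poch q q j * (poch (p * q / b) q j * poch (p * q / c) q j * poch (p * q / d) q j))
  * (p / a) ^ j * (poch (p * q) q (2 * j) / poch (a * q) q (2 * j))
  * (poch s q j * poch (- s) q j / (poch (p * q / s) q j * poch (- (p * q / s)) q j))
  * (- q) ^ j.

Definition bailey_inner (j : nat) : nat -> C :=
  phi65 (p * q ^ (2 * j)) (p / a) (s * q ^ j) (- (s * q ^ j)) q.

Definition vwp_term (n : nat) : C :=
  vwp p q n / poch q q n
  * (poch s q n * poch (- s) q n * poch b q n * poch c q n * poch d q n
     / (poch (p * q / s) q n * poch (- (p * q / s)) q n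
        * poch (p * q / b) q n * poch (p * q / c) q n * poch (p * q / d) q n))
  * (- q) ^ n.

Definition wp_term (j : nat) : C :=
  poch a q j * poch (a * b / p) q j * poch (a * c / p) q j * poch (a * d / p) q j
  / (poch q q j * (poch (p * q / b) q j * poch (p * q / c) q j * poch (p * q / d) q j))
  * (- (p * q / a)) ^ j.

(** It contains [(pq;q)] at infinity where the theorem has [(q;q)]; the discrepancy is the factor
    [w] of [psi_phi]. *)
Definition prefactor : C :=
  qpoch_inf (p * q) q * qpoch_inf (- (p * q / a)) q * qpoch_inf (q * s) q * qpoch_inf (- (q * s)) q
  / (qpoch_inf (a * q) q * qpoch_inf (- q) q * qpoch_inf (p * q / s) q
     * qpoch_inf (- (p * q / s)) q).

Lemma q_neq_0 : q <> 0.
Proof. now apply Cmod_gt_0. Qed.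

Lemma a_neq_0 : a <> 0.
Proof. rewrite <- Hsa. now apply Cpow_nz. Qed.

Lemma bailey_pair_b (j : nat) : p * q ^ (2 * j) * q / (p / a) = a * q * q ^ (2 * j).
Proof. pose proof a_neq_0. field. auto. Qed.

Lemma bailey_pair_c (j : nat) : p * q ^ (2 * j) * q / (s * q ^ j) = p * q / s * q ^ j.
Proof.
  pose proof (Cpow_nz _ j q_neq_0). replace (2 * j)%nat with (j + j)%nat by lia.
  rewrite Cpow_add_r. field. auto.
Qed.

Lemma bailey_pair_d (j : nat) : p * q ^ (2 * j) * q / (- (s * q ^ j)) = - (p * q / s) * q ^ j.
Proof.
  pose proof (Cpow_nz _ j q_neq_0). replace (2 * j)%nat with (j + j)%nat by lia.
  rewrite Cpow_add_r. field. auto.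
Qed.

(** The powers of [q^j] cancel because [(s q^j)(- s q^j) = - a q^(2j)]. *)
Lemma bailey_argument (j : nat) : p * q ^ (2 * j) * q / (p / a * (s * q ^ j) * - (s * q ^ j)) = - q.
Proof.
  pose proof (Cpow_nz _ j q_neq_0). pose proof a_neq_0.
  replace (2 * j)%nat with (j + j)%nat by lia.
  rewrite Cpow_add_r, <- Hsa. field. auto.
Qed.

(** Every factorial of index [j + m] or [2j + m] splits by [poch_add], the factor [(q;q)_(j+m)]
    cancels, and [vwp_split] changes the base. *)
Lemma jackson_bailey (j m : nat) :
  vwp p q (j + m) / poch q q (j + m)
  * (poch s q (j + m) * poch (- s) q (j + m)
     / (poch (p * q / s) q (j + m) * poch (- (p * q / s)) q (j + m)))
  * (- q) ^ (j + m) * jackson q a p b c d (j + m) j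
  = bailey_coef j * bailey_inner j m.
Proof.
  unfold bailey_inner, phi65. rewrite bailey_pair_b, bailey_pair_c, bailey_pair_d, bailey_argument.
  unfold jackson, bailey_coef. replace (j + m - j)%nat with m by lia.
  replace (j + m + j)%nat with (2 * j + m)%nat by lia.
  replace (- (s * q ^ j)) with (- s * q ^ j) by ring.
  pose proof (vwp_split p q j m) as Hv.
  rewrite (poch_add s), (poch_add (- s)), (poch_add (p * q / s)), (poch_add (- (p * q / s))),
    (poch_add (a * q)), (Cpow_add_r (- q)).
  pose proof (poch_neq_0 _ _ j Wq). pose proof (poch_neq_0 _ _ m Wq).
  pose proof (poch_neq_0 _ _ (j + m) Wq).
  pose proof (poch_neq_0 _ _ j Wb). pose proof (poch_neq_0 _ _ j Wc).
  pose proof (poch_neq_0 _ _ j Wd). pose proof (poch_neq_0 _ _ j Ws).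
  pose proof (poch_neq_0 _ _ j Ws'). pose proof (poch_neq_0 _ _ (2 * j) Wa).
  pose proof (poch_neq_0 _ _ m (den_wd_shift _ _ (2 * j) Wa)).
  pose proof (poch_neq_0 _ _ m (den_wd_shift _ _ j Ws)).
  pose proof (poch_neq_0 _ _ m (den_wd_shift _ _ j Ws')).
  set (P1 := poch (p * q ^ (j + m)) q j) in *. set (V1 := vwp p q (j + m)) in *.
  set (P2 := poch (p * q) q (2 * j)) in *. set (V2 := vwp (p * q ^ (2 * j)) q m) in *.
  set (X := (p / a) ^ j). set (Y := (- q) ^ j). set (Z := (- q) ^ m).
  set (e1 := poch (p * q / b) q j) in *. set (e2 := poch (p * q / c) q j) in *.
  set (e3 := poch (p * q / d) q j) in *.
  (* The cofactor common to both sides, which then differ only by [vwp_split]. *)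
  set (R := vwp a q j
    * (poch (a * b / p) q j * poch (a * c / p) q j * poch (a * d / p) q j)
    / (poch q q j * (e1 * e2 * e3)) * X * Y * Z
    * (poch s q j * poch (s * q ^ j) q m * (poch (- s) q j * poch (- s * q ^ j) q m)
     / (poch (p * q / s) q j * poch (p * q / s * q ^ j) q m
       * (poch (- (p * q / s)) q j * poch (- (p * q / s) * q ^ j) q m)))
    / poch q q m * poch (p / a) q m
    / (poch (a * q) q (2 * j) * poch (a * q * q ^ (2 * j)) q m)).
  transitivity (R * (V1 * P1)); [|rewrite Hv]; unfold R;
    clearbody P1 V1 P2 V2 X Y Z e1 e2 e3; field; repeat split; auto.
Qed.

(** [jackson_sum] read from right to left, multiplied by the factors of [vwp_term n] that do not
    involve [b, c, d]. *)
Lemma bailey_sum (n : nat) :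
  vwp_term n = Csum (fun j => bailey_coef j * bailey_inner j (n - j)) (S n).
Proof.
  transitivity (Csum (fun j => vwp p q n / poch q q n
    * (poch s q n * poch (- s) q n / (poch (p * q / s) q n * poch (- (p * q / s)) q n))
    * (- q) ^ n * jackson q a p b c d n j) (S n)).
  - rewrite Csum_scal, jackson_sum; auto using q_neq_0, a_neq_0.
    unfold vwp_term.
    pose proof (poch_neq_0 _ _ n Wq). pose proof (poch_neq_0 _ _ n Wb).
    pose proof (poch_neq_0 _ _ n Wc). pose proof (poch_neq_0 _ _ n Wd).
    pose proof (poch_neq_0 _ _ n Ws). pose proof (poch_neq_0 _ _ n Ws').
    set (e1 := poch (p * q / b) q n) in *. set (e2 := poch (p * q / c) q n) in *.
    set (e3 := poch (p * q / d) q n) in *. set (e4 := poch (p * q / s) q n) in *.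
    set (e5 := poch (- (p * q / s)) q n) in *. clearbody e1 e2 e3 e4 e5.
    field. repeat split; auto.
  - apply Csum_ext. intros j Hj. rewrite <- jackson_bailey.
    now replace (j + (n - j))%nat with n by lia.
Qed.

(** The finite factorials in [bailey_coef] complete the shifted infinite products of the 6phi5 value
    to those of [prefactor]; the leftover [(s,-s)_j / (sq,-sq)_j] is absorbed by [vwp_sqr]. *)
Lemma bailey_term (j : nat) :
  bailey_coef j
  * (qpoch_inf (p * q ^ (2 * j) * q) q
     * qpoch_inf (p * q ^ (2 * j) * q / (p / a * (s * q ^ j))) q
     * qpoch_inf (p * q ^ (2 * j) * q / (p / a * - (s * q ^ j))) q
     * qpoch_inf (p * q ^ (2 * j) * q / (s * q ^ j * - (s * q ^ j))) q
     / (qpoch_inf (p * q ^ (2 * j) * q / (p / a)) q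
        * qpoch_inf (p * q ^ (2 * j) * q / (s * q ^ j)) q
        * qpoch_inf (p * q ^ (2 * j) * q / - (s * q ^ j)) q
        * qpoch_inf (p * q ^ (2 * j) * q / (p / a * (s * q ^ j) * - (s * q ^ j))) q))
  = prefactor * wp_term j.
Proof.
  rewrite bailey_pair_b, bailey_pair_c, bailey_pair_d, bailey_argument.
  pose proof q_neq_0. pose proof a_neq_0. pose proof (Cpow_nz _ j q_neq_0).
  assert (E1 : p * q ^ (2 * j) * q / (p / a * (s * q ^ j)) = s * q * q ^ j).
  { replace (2 * j)%nat with (j + j)%nat by lia. rewrite Cpow_add_r, <- Hsa. field. auto. }
  assert (E2 : p * q ^ (2 * j) * q / (p / a * - (s * q ^ j)) = - s * q * q ^ j).
  { replace (2 * j)%nat with (j + j)%nat by lia. rewrite Cpow_add_r, <- Hsa. field. auto. }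
  assert (E3 : p * q ^ (2 * j) * q / (s * q ^ j * - (s * q ^ j)) = - (p * q / a)).
  { replace (2 * j)%nat with (j + j)%nat by lia. rewrite Cpow_add_r, <- Hsa. field. auto. }
  rewrite E1, E2, E3. replace (p * q ^ (2 * j) * q) with (p * q * q ^ (2 * j)) by ring.
  unfold prefactor. replace (q * s) with (s * q) by ring.
  replace (- (s * q)) with (- s * q) by ring.
  destruct Hq as [_ Hq1].
  rewrite (qpoch_inf_shift (p * q) q (2 * j) Hq1), (qpoch_inf_shift (s * q) q j Hq1),
    (qpoch_inf_shift (- s * q) q j Hq1), (qpoch_inf_shift (a * q) q (2 * j) Hq1),
    (qpoch_inf_shift (p * q / s) q j Hq1), (qpoch_inf_shift (- (p * q / s)) q j Hq1).
  unfold bailey_coef, wp_term.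
  assert (EP : (- (p * q / a)) ^ j = (p / a) ^ j * (- q) ^ j).
  { rewrite <- Cpow_mult_l. f_equal. field. auto. }
  rewrite EP.
  pose proof (vwp_sqr s a q j Hsa) as Hv.
  pose proof (poch_neq_0 _ _ j Wq).
  pose proof (poch_neq_0 _ _ j Wb). pose proof (poch_neq_0 _ _ j Wc).
  pose proof (poch_neq_0 _ _ j Wd). pose proof (poch_neq_0 _ _ j Ws).
  pose proof (poch_neq_0 _ _ j Ws'). pose proof (poch_neq_0 _ _ (2 * j) Wa).
  assert (Wmq : den_wd q (- q)) by (apply den_wd_small; [lra | now rewrite Cmod_opp]).
  pose proof (proj2 (qpoch_inf_neq_0 _ _ Hq1) Wmq).
  pose proof (proj2 (qpoch_inf_neq_0 _ _ Hq1) (den_wd_shift _ _ (2 * j) Wa)).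
  pose proof (proj2 (qpoch_inf_neq_0 _ _ Hq1) (den_wd_shift _ _ j Ws)).
  pose proof (proj2 (qpoch_inf_neq_0 _ _ Hq1) (den_wd_shift _ _ j Ws')).
  set (e1 := poch (p * q / b) q j) in *. set (e2 := poch (p * q / c) q j) in *.
  set (e3 := poch (p * q / d) q j) in *. set (e4 := poch (p * q / s) q j) in *.
  set (e5 := poch (- (p * q / s)) q j) in *.
  set (V := vwp a q j) in *. set (X := (p / a) ^ j). set (Y := (- q) ^ j).
  set (I1 := qpoch_inf (- (p * q / a)) q).
  set (I2 := qpoch_inf (p * q / s * q ^ j) q) in *.
  set (I3 := qpoch_inf (- (p * q / s) * q ^ j) q) in *.
  set (P1 := poch (s * q) q j) in *. set (P2 := poch (- s * q) q j) in *.
  set (P3 := poch s q j) in *. set (P4 := poch (- s) q j) in *.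
  transitivity (V * (P3 * P4) * ((poch (a * b / p) q j * poch (a * c / p) q j * poch (a * d / p) q j)
    / (poch q q j * (e1 * e2 * e3)) * X * Y * poch (p * q) q (2 * j) / poch (a * q) q (2 * j)
    / (e4 * e5) * (qpoch_inf (p * q * q ^ (2 * j)) q * qpoch_inf (s * q * q ^ j) q
      * qpoch_inf (- s * q * q ^ j) q * I1 / (qpoch_inf (a * q * q ^ (2 * j)) q * I2 * I3
        * qpoch_inf (- q) q)))); [|rewrite Hv];
  clearbody e1 e2 e3 e4 e5 V X Y I1 I2 I3 P1 P2 P3 P4; field; repeat split; auto.
Qed.

Lemma bailey_coef_bound :
  exists M, (0 < M)%R /\ forall j, (Cmod (bailey_coef j) <= M * Cmod (p * q / a) ^ j)%R.
Proof.
  destruct Hq as [_ Hq1].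
  assert (H : Cbounded (fun j => vwp a q j
    * (poch (a * b / p) q j * poch (a * c / p) q j * poch (a * d / p) q j)
    * (/ poch q q j * (/ poch (p * q / b) q j * / poch (p * q / c) q j * / poch (p * q / d) q j))
    * (poch (p * q) q (2 * j) * / poch (a * q) q (2 * j))
    * (poch s q j * poch (- s) q j * (/ poch (p * q / s) q j * / poch (- (p * q / s)) q j))))
    by cbounded.
  destruct H as [M [HM H]]. exists M. split; auto. intros j.
  specialize (H j). set (u := _ * _) in H.
  replace (bailey_coef j) with (u * (p / a * - q) ^ j).
  - rewrite Cmod_mult, (Cmod_pow (p / a * - q)).
    replace (p / a * - q) with (- (p * q / a)) by (unfold Cdiv; ring). rewrite Cmod_opp.
    apply Rmult_le_compat_r; [apply pow_le, Cmod_ge_0 | exact H].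
  - unfold u, bailey_coef, Cdiv. rewrite !Cinv_mult, Cpow_mult_l. ring.
Qed.

Lemma wp_term_bound :
  exists M, (0 < M)%R /\ forall j, (Cmod (wp_term j) <= M * Cmod (p * q / a) ^ j)%R.
Proof.
  destruct Hq as [_ Hq1].
  assert (H : Cbounded (fun j => poch a q j
    * (poch (a * b / p) q j * poch (a * c / p) q j * poch (a * d / p) q j)
    * (/ poch q q j * (/ poch (p * q / b) q j * / poch (p * q / c) q j * / poch (p * q / d) q j))))
    by cbounded.
  destruct H as [M [HM H]]. exists M. split; auto. intros j.
  specialize (H j). set (u := _ * _) in H.
  replace (wp_term j) with (u * (- (p * q / a)) ^ j).
  - rewrite Cmod_mult, (Cmod_pow (- (p * q / a))), Cmod_opp.
    apply Rmult_le_compat_r; [apply pow_le, Cmod_ge_0 | exact H].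
  - unfold u, wp_term. set (w := (- (p * q / a)) ^ j). unfold Cdiv. rewrite !Cinv_mult. ring.
Qed.

(** The constant does not depend on [j]: all parameters of the inner sum are shifts of fixed
    ones. *)
Lemma bailey_inner_bound :
  exists M, (0 < M)%R /\ forall j m, (Cmod (bailey_inner j m) <= M * Cmod q ^ m)%R.
Proof.
  destruct Hq as [_ Hq1].
  destruct (phi65_family_bounded p (p / a) s (- s) (a * q) (p * q / s) (- (p * q / s)) q
    Hq1 Wq Wa Ws Ws') as [M [HM H]].
  exists M. split; auto. intros j m. unfold bailey_inner, phi65.
  rewrite bailey_pair_b, bailey_pair_c, bailey_pair_d, bailey_argument.
  specialize (H (2 * j)%nat O j j (2 * j)%nat j j m). cbn [Cpow] in H.
  rewrite Cmult_1_r in H. replace (- (s * q ^ j)) with (- s * q ^ j) by ring.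
  rewrite Cmod_mult, (Cmod_pow (- q)), Cmod_opp.
  apply Rmult_le_compat_r; [apply pow_le, Cmod_ge_0 | exact H].
Qed.

Lemma well_poised_transform :
  exists l, Ccv_series wp_term l /\ Ccv_series vwp_term (prefactor * l).
Proof.
  pose proof Hq as [Hq0 Hq1].
  destruct wp_term_bound as [M0 [HM0 H0]].
  destruct (Ccv_series_geom wp_term M0 (Cmod (p * q / a))) as [l Hl]; auto.
  { split; [apply Cmod_ge_0 | exact Hz]. }
  exists l. split; auto.
  destruct bailey_coef_bound as [M1 [HM1 H1]].
  destruct bailey_inner_bound as [M2 [HM2 H2]].
  (* The outer sum decays at rate [|pq/a|], the inner ones at rate [|q|]; [Ccv_series_triangle]
     takes a single rate in [j + m]. *)
  set (r := Rmax (Cmod (p * q / a)) (Cmod q)).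
  assert (Hr : (0 <= r < 1)%R).
  { unfold r. split; [|now apply Rmax_lub_lt].
    eapply Rle_trans; [apply Cmod_ge_0 | apply Rmax_r]. }
  assert (H : Ccv_series (fun n => Csum (fun j => bailey_coef j * bailey_inner j (n - j)) (S n))
    (prefactor * l)).
  { apply (Ccv_series_triangle (fun j m => bailey_coef j * bailey_inner j m)
      (fun j => prefactor * wp_term j) _ (M1 * M2)%R r); auto.
    - nra.
    - intros j m. rewrite Cmod_mult, pow_add.
      replace (M1 * M2 * (r ^ j * r ^ m))%R with ((M1 * r ^ j) * (M2 * r ^ m))%R by ring.
      apply Rmult_le_compat; try apply Cmod_ge_0.
      + eapply Rle_trans; [apply H1|]. apply Rmult_le_compat_l; [lra|].
        apply pow_incr. split; [apply Cmod_ge_0 | apply Rmax_l].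
      + eapply Rle_trans; [apply H2|]. apply Rmult_le_compat_l; [lra|].
        apply pow_incr. split; [apply Cmod_ge_0 | apply Rmax_r].
    - intros j. rewrite <- bailey_term. unfold Ccv_series.
      apply Ccv_ext with (fun n => bailey_coef j * Csum (bailey_inner j) n).
      + intros n. now rewrite Csum_scal.
      + apply Ccv_scal. pose proof (Cpow_nz _ j q_neq_0).
        apply phi65_sum; auto.
        * apply Cmult_neq_0; auto. intros E. apply (f_equal (Cmult a)) in E.
          pose proof a_neq_0 as Ha. rewrite Cinv_r, Cmult_0_r in E by auto. now apply C1_nz.
        * now apply Cmult_neq_0.
        * intros E. apply (Cmult_neq_0 s (q ^ j)); auto.
          replace (s * q ^ j) with (- - (s * q ^ j)) by ring. rewrite E. ring.
        * replace (p * q ^ (2 * j) * q) with (p * q * q ^ (2 * j)) by ring.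
          now apply den_wd_shift.
        * rewrite bailey_pair_b. now apply den_wd_shift.
        * rewrite bailey_pair_c. now apply den_wd_shift.
        * rewrite bailey_pair_d. now apply den_wd_shift.
        * rewrite bailey_argument, Cmod_opp. exact Hq1.
    - unfold Ccv_series. apply Ccv_ext with (fun n => prefactor * Csum wp_term n).
      + intros n. now rewrite Csum_scal.
      + now apply Ccv_scal. }
  unfold Ccv_series in *. apply Ccv_ext with (2 := H).
  intros n. apply Csum_ext. intros k _. symmetry. apply bailey_sum.
Qed.

End Transform.

(** * Reflection of the bilateral series *)

Lemma qpoch_of_nat (x q : C) (n : nat) : qpoch x q (Z.of_nat n) = poch x q n.
Proof.
  destruct n as [|n]; [reflexivity|].
  cbn [Z.of_nat qpoch]. now rewrite SuccNat2Pos.id_succ.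
Qed.

Lemma CpowZ_of_nat (z : C) (n : nat) : CpowZ z (Z.of_nat n) = z ^ n.
Proof.
  destruct n as [|n]; [reflexivity|].
  cbn [Z.of_nat CpowZ]. now rewrite SuccNat2Pos.id_succ.
Qed.

Lemma CpowZ_opp (z : C) (n : nat) : CpowZ z (- Z.of_nat (S n)) = / z ^ S n.
Proof. cbn [Z.of_nat Z.opp CpowZ]. now rewrite SuccNat2Pos.id_succ. Qed.

Lemma Cinv_1 : / RtoC 1 = 1.
Proof. field. Qed.

Lemma Cdiv_1_r (x : C) : x / 1 = x.
Proof. field. Qed.

Lemma Cdiv_mult_mult (x y z w : C) : (x * y) / (z * w) = (x / z) * (y / w).
Proof. unfold Cdiv. rewrite Cinv_mult. ring. Qed.

Lemma Cdiv_inv_inv (x y : C) : / x / / y = y / x.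
Proof. unfold Cdiv. rewrite Cinv_inv. ring. Qed.

(** Factor by factor: [(1 - (pq/x) q^(-m-1)) / (1 - x q^(-m-1)) = (pq/x^2) (1 - (x/p) q^m) / (1 -
    (q/x) q^m)]. A zero of the numerator on the left is allowed: both sides of the lemma are then
    0. *)
Lemma qpoch_reflect (x p q : C) (n : nat) :
  q <> 0 -> p <> 0 -> x <> 0 -> num_wd q x ->
  qpoch x q (- Z.of_nat (S n)) / qpoch (p * q / x) q (- Z.of_nat (S n))
  = (p * q / x ^ 2) ^ S n * (poch (x / p) q (S n) / poch (q / x) q (S n)).
Proof.
  intros Hq Hp Hx W. cbn [Z.of_nat Z.opp qpoch]. rewrite SuccNat2Pos.id_succ.
  generalize (S n) as m. induction m as [|m IH].
  - cbn. field.
  - cbn [Cprod]. rewrite Cdiv_mult_mult, IH, !poch_S, (Cpow_S (p * q / x ^ 2)).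
    pose proof (W m) as Wm. pose proof (Cpow_nz _ m Hq) as Hqm.
    assert (Wx : 1 - q / x * q ^ m <> 0).
    { apply (neq_0_scale (- (q * q ^ m / x)) (1 - x * / q ^ S m)); auto.
      - intros E. apply (Cmult_neq_0 q (q ^ m)); auto.
        replace (q * q ^ m) with (- (- (q * q ^ m / x)) * x) by (field; auto). rewrite E. ring.
      - rewrite Cpow_S. field. auto. }
    transitivity ((p * q / x ^ 2) ^ m * (poch (x / p) q m / poch (q / x) q m)
      * ((1 - p * q / x * / q ^ S m) / (1 - x * / q ^ S m))).
    + f_equal. apply Cdiv_inv_inv.
    + replace ((1 - p * q / x * / q ^ S m) / (1 - x * / q ^ S m))
        with (p * q / x ^ 2 * ((1 - x / p * q ^ m) / (1 - q / x * q ^ m))).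
      * rewrite !Cdiv_mult_mult. ring.
      * rewrite (Cpow_S q m) in *. set (y := q ^ m) in *. clearbody y.
        assert (N1 : x - q * y <> 0) by (apply (neq_0_scale x _ _ Hx Wx); field; auto).
        assert (N2 : q * y - x <> 0).
        { apply (neq_0_scale (q * y) _ _) with (2 := Wm); [now apply Cmult_neq_0 | field; auto]. }
        field_simplify_eq; [ring | repeat split; auto].
Qed.

Section Reflection.

Context (q a p b c d s : C).
Context (Hq : (0 < Cmod q < 1)%R) (Hsa : s ^ 2 = a) (Hp : p <> 0) (Hs : s <> 0)
  (Hb : b <> 0) (Hc : c <> 0) (Hd : d <> 0)
  (Habcd : a * b * c * d = q * p ^ 2)
  (Wpsi : psi_wd [s; - s; b; c; d]
     [p * q / s; - (p * q / s); p * q / b; p * q / c; p * q / d] q).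

Let t := psi_term [s; - s; b; c; d]
  [p * q / s; - (p * q / s); p * q / b; p * q / c; p * q / d] q (- q).

Definition wp_quot (n : nat) : C :=
  poch s q n * poch (- s) q n * poch b q n * poch c q n * poch d q n
  / (poch (p * q / s) q n * poch (- (p * q / s)) q n
     * poch (p * q / b) q n * poch (p * q / c) q n * poch (p * q / d) q n).

Lemma psi_term_nonneg (n : nat) : t (Z.of_nat n) = wp_quot n * (- q) ^ n.
Proof.
  unfold t, psi_term, qpochs. cbn [map Clist_prod fold_right].
  rewrite !qpoch_of_nat, CpowZ_of_nat. unfold wp_quot, Cdiv. rewrite !Cinv_mult, Cinv_1. ring.
Qed.

Lemma psi_term_neg (n : nat) :
  t (- Z.of_nat (S n))
  = (- (p * q ^ 2)) ^ S n
    * (poch (s / p) q (S n) * poch (- s / p) q (S n) * poch (b / p) q (S n)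
       * poch (c / p) q (S n) * poch (d / p) q (S n)
       / (poch (q / s) q (S n) * poch (q / - s) q (S n) * poch (q / b) q (S n)
       * poch (q / c) q (S n) * poch (q / d) q (S n))).
Proof.
  assert (Hq0 : q <> 0) by now apply Cmod_gt_0.
  assert (Hs' : - s <> 0) by (intros E; apply Hs; replace s with (- - s) by ring; rewrite E; ring).
  destruct Wpsi as [Wn _]. rewrite !Forall_cons_iff in Wn.
  destruct Wn as [W1 [W2 [W3 [W4 [W5 _]]]]].
  pose proof (qpoch_reflect s p q n Hq0 Hp Hs W1) as R1.
  pose proof (qpoch_reflect (- s) p q n Hq0 Hp Hs' W2) as R2.
  pose proof (qpoch_reflect b p q n Hq0 Hp Hb W3) as R3.
  pose proof (qpoch_reflect c p q n Hq0 Hp Hc W4) as R4.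
  pose proof (qpoch_reflect d p q n Hq0 Hp Hd W5) as R5.
  replace (p * q / - s) with (- (p * q / s)) in R2 by (field; auto).
  unfold t, psi_term, qpochs. cbn [map Clist_prod fold_right]. rewrite CpowZ_opp.
  set (k := (- Z.of_nat (S n))%Z) in *.
  transitivity ((qpoch s q k / qpoch (p * q / s) q k) * (qpoch (- s) q k / qpoch (- (p * q / s)) q k)
    * (qpoch b q k / qpoch (p * q / b) q k) * (qpoch c q k / qpoch (p * q / c) q k)
    * (qpoch d q k / qpoch (p * q / d) q k) * / (- q) ^ S n).
  { unfold Cdiv. rewrite !Cinv_mult, Cinv_1. ring. }
  rewrite R1, R2, R3, R4, R5.
  (* The five reflection constants and the argument [-q] combine to [(pq)^5 / (abcd)^2 * (-1/q)],
     which is [- p q^2] by the balancing condition. *)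
  assert (E : p * q / s ^ 2 * (p * q / (- s) ^ 2) * (p * q / b ^ 2) * (p * q / c ^ 2)
    * (p * q / d ^ 2) * / - q = - (p * q ^ 2)).
  { assert (Ed : d = q * p ^ 2 / (s ^ 2 * b * c)).
    { rewrite Hsa, <- Habcd. field. repeat split; auto. rewrite <- Hsa. now apply Cpow_nz. }
    rewrite Ed. field. repeat split; auto. }
  rewrite <- E, !Cpow_mult_l, Cpow_inv.
  - unfold Cdiv. rewrite !Cinv_mult. ring.
  - intros E'. apply Hq0. replace q with (- - q) by ring. rewrite E'. ring.
Qed.

Lemma wp_quot_bound :
  exists M, (0 < M)%R /\ forall n, (Cmod (wp_quot n) <= M)%R.
Proof.
  destruct Hq as [_ Hq1]. destruct Wpsi as [_ Wn]. rewrite !Forall_cons_iff in Wn.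
  destruct Wn as [W1 [W2 [W3 [W4 [W5 _]]]]].
  assert (H : Cbounded (fun n =>
    poch s q n * poch (- s) q n * poch b q n * poch c q n * poch d q n
    * (/ poch (p * q / s) q n * / poch (- (p * q / s)) q n
     * / poch (p * q / b) q n * / poch (p * q / c) q n * / poch (p * q / d) q n))) by cbounded.
  destruct H as [M [HM H]]. exists M. split; auto. intros n.
  unfold wp_quot, Cdiv at 1. rewrite !Cinv_mult. apply H.
Qed.

End Reflection.

(** * Folding the bilateral series for [p = 1] and [p = q] *)

Lemma bilateral_halves (t : Z -> C) (u v : nat -> C) (l m : C) :
  (forall n, t (Z.of_nat n) = u n) -> (forall n, t (- Z.of_nat (S n))%Z = v n) ->
  Ccv_series u l -> Ccv_series v m ->
  ex_bilateral t /\ bilateral t = l + m.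
Proof.
  intros Hu Hv Cu Cv.
  assert (C1 : Ccv_series (fun n => t (Z.of_nat n)) l).
  { unfold Ccv_series in *. apply Ccv_ext with (2 := Cu). intros n. apply Csum_ext. auto. }
  assert (C2 : Ccv_series (fun n => t (- Z.of_nat (S n))%Z) m).
  { unfold Ccv_series in *. apply Ccv_ext with (2 := Cv). intros n. apply Csum_ext. auto. }
  split.
  - split; eexists; apply Ccv_series_is_series; eassumption.
  - unfold bilateral. now rewrite (CSeries_unique _ _ C1), (CSeries_unique _ _ C2).
Qed.

Lemma series_geom_pow (w : nat -> C) (q : C) (M : R) :
  (Cmod q < 1)%R -> (forall n, (Cmod (w n) <= M)%R) ->
  exists l, Ccv_series (fun n => w n * (- q) ^ n) l.
Proof.
  intros Hq Hw. apply Ccv_series_geom with M (Cmod q).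
  - split; [apply Cmod_ge_0 | exact Hq].
  - intros i. rewrite Cmod_mult, (Cmod_pow (- q)), Cmod_opp.
    apply Rmult_le_compat_r; [apply pow_le, Cmod_ge_0 | apply Hw].
Qed.

(** The weight of the pair [k = n+1] and [k = -(n+1)] for [p = 1]. At index 0 the quotient is 1 and
    not 2, as it must be, [k = 0] being its own mirror image. *)
Lemma vwp_1_quot (q : C) (n : nat) :
  den_wd q q -> vwp 1 q (S n) / poch q q (S n) = 1 + q ^ S n.
Proof.
  intros W. pose proof (poch_neq_0 _ _ n W). pose proof (W n) as Wn.
  cbn [vwp]. rewrite poch_S, Nat.mul_comm, Cpow_mult_r, !Cmult_1_l, (Cpow_S q n) in *.
  field. auto.
Qed.

(** The weight of the pair [k = n] and [k = -1-n] for [p = q]; no index is fixed, so [n = 0] is no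
    exception. *)
Lemma vwp_q_quot (q : C) (n : nat) :
  den_wd q q -> (1 - q) * (vwp q q n / poch q q n) = 1 - q ^ S (2 * n).
Proof.
  intros W. pose proof (den_wd_0 _ _ W). destruct n as [|n].
  - cbn. field.
  - pose proof (poch_neq_0 _ _ (S n) W) as Hp. cbn [vwp].
    rewrite (poch_shift_div q q n), <- poch_S by assumption.
    rewrite (Cpow_S q (2 * S n)). field. auto.
Qed.

Lemma psi_base_1 (q a b c d s : C) :
  (0 < Cmod q < 1)%R -> s ^ 2 = a -> s <> 0 -> b <> 0 -> c <> 0 -> d <> 0 ->
  a * b * c * d = q * 1 ^ 2 ->
  psi_wd [s; - s; b; c; d]
    [1 * q / s; - (1 * q / s); 1 * q / b; 1 * q / c; 1 * q / d] q ->
  den_wd q q ->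
  forall L, Ccv_series (vwp_term q 1 b c d s) L ->
  let t := psi_term [s; - s; b; c; d]
    [1 * q / s; - (1 * q / s); 1 * q / b; 1 * q / c; 1 * q / d] q (- q) in
  ex_bilateral t /\ bilateral t = L.
Proof.
  intros Hq Hsa Hs Hb Hc Hd H W Wq L HL t.
  assert (Hp : RtoC 1 <> 0) by apply C1_nz.
  pose proof Hq as [_ Hq1].
  pose (u := fun n => wp_quot q 1 b c d s n * (- q) ^ n).
  destruct (wp_quot_bound q 1 b c d s Hq W) as [M [HM HMb]].
  destruct (series_geom_pow _ q M Hq1 HMb) as [l Hl]. fold u in Hl.
  assert (Hv : exists m, Ccv_series (fun n => q ^ S n * u (S n)) m).
  { apply Ccv_series_geom with M (Cmod q).
    - split; [apply Cmod_ge_0 | exact Hq1].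
    - intros n. unfold u. rewrite !Cmod_mult, (Cmod_pow q), (Cmod_pow (- q)), Cmod_opp.
      pose proof (HMb (S n)). pose proof (Cmod_ge_0 (wp_quot q 1 b c d s (S n))).
      pose proof (pow_le _ n (Cmod_ge_0 q)).
      assert (Cmod q ^ S n <= Cmod q ^ n)%R by (simpl; nra).
      assert (Cmod q ^ S n <= 1)%R.
      { rewrite <- (pow1 (S n)). apply pow_incr. split; [apply Cmod_ge_0 | lra]. }
      pose proof (pow_le _ (S n) (Cmod_ge_0 q)).
      apply Rle_trans with (1 * (M * Cmod q ^ n))%R; [|lra].
      apply Rmult_le_compat; auto; [now apply Rmult_le_pos|].
      apply Rmult_le_compat; auto. }
  destruct Hv as [m Hm].
  (* The nonnegative half has one more term than the negative one, [k = 0] being unpaired; hence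
     [n + 1] against [n]. *)
  assert (E : L = l + m).
  { apply Ccv_unique with (fun n => Csum (vwp_term q 1 b c d s) (n + 1)).
    - apply Ccv_incr, HL.
    - apply Ccv_ext with (fun n => Csum u (n + 1) + Csum (fun n => q ^ S n * u (S n)) n).
      + intros n. rewrite Nat.add_1_r, !Csum_S_l, <- Cplus_assoc, <- Csum_plus. f_equal.
        * unfold u, vwp_term, wp_quot. cbn. field.
        * apply Csum_ext. intros k _. unfold u, vwp_term. rewrite vwp_1_quot by exact Wq.
          unfold wp_quot. ring.
      + apply Ccv_plus; [apply Ccv_incr, Hl | exact Hm]. }
  rewrite E. apply (bilateral_halves t _ _ l m) with (3 := Hl) (4 := Hm).
  - intros n. apply psi_term_nonneg.
  - intros n. unfold t. rewrite (psi_term_neg q a 1 b c d s) by assumption.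
    unfold u, wp_quot. rewrite !Cdiv_1_r, !Cmult_1_l.
    replace (q / - s) with (- (q / s)) by (field; auto).
    replace (- q ^ 2) with (q * - q) by ring. rewrite Cpow_mult_l. ring.
Qed.

Lemma psi_base_q (q a b c d s : C) :
  (0 < Cmod q < 1)%R -> s ^ 2 = a -> s <> 0 -> b <> 0 -> c <> 0 -> d <> 0 ->
  a * b * c * d = q * q ^ 2 ->
  psi_wd [s; - s; b; c; d]
    [q * q / s; - (q * q / s); q * q / b; q * q / c; q * q / d] q ->
  den_wd q q ->
  forall L, Ccv_series (vwp_term q q b c d s) L ->
  let t := psi_term [s; - s; b; c; d]
    [q * q / s; - (q * q / s); q * q / b; q * q / c; q * q / d] q (- q) in
  ex_bilateral t /\ bilateral t = (1 - q) * L.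
Proof.
  intros Hq Hsa Hs Hb Hc Hd H W Wq L HL t.
  pose proof Hq as [Hq0' Hq1]. assert (Hq0 : q <> 0) by now apply Cmod_gt_0.
  pose (u := fun n => wp_quot q q b c d s n * (- q) ^ n).
  destruct (wp_quot_bound q q b c d s Hq W) as [M [HM HMb]].
  destruct (series_geom_pow _ q M Hq1 HMb) as [l Hl]. fold u in Hl.
  assert (Hv : exists m, Ccv_series (fun n => - q ^ S (2 * n) * u n) m).
  { apply Ccv_series_geom with M (Cmod q).
    - split; [apply Cmod_ge_0 | exact Hq1].
    - intros n. unfold u. rewrite !Cmod_mult, Cmod_opp, (Cmod_pow q), (Cmod_pow (- q)), Cmod_opp.
      pose proof (HMb n). pose proof (Cmod_ge_0 (wp_quot q q b c d s n)).
      pose proof (pow_le _ n (Cmod_ge_0 q)).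
      assert (Cmod q ^ S (2 * n) <= 1)%R.
      { rewrite <- (pow1 (S (2 * n))). apply pow_incr. split; [apply Cmod_ge_0 | lra]. }
      pose proof (pow_le _ (S (2 * n)) (Cmod_ge_0 q)).
      apply Rle_trans with (1 * (M * Cmod q ^ n))%R; [|lra].
      apply Rmult_le_compat; auto; [now apply Rmult_le_pos|].
      apply Rmult_le_compat_r; auto. }
  destruct Hv as [m Hm].
  assert (E : (1 - q) * L = l + m).
  { apply Ccv_unique with (fun n => (1 - q) * Csum (vwp_term q q b c d s) n).
    - apply Ccv_scal, HL.
    - apply Ccv_ext with (fun n => Csum u n + Csum (fun n => - q ^ S (2 * n) * u n) n).
      + intros n. rewrite <- Csum_plus, <- Csum_scal.
        apply Csum_ext. intros k _. unfold u.
        transitivity ((1 - q) * (vwp q q k / poch q q k) * (wp_quot q q b c d s k * (- q) ^ k)).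
        * rewrite vwp_q_quot by exact Wq. ring.
        * unfold vwp_term, wp_quot. ring.
      + now apply Ccv_plus. }
  rewrite E. apply (bilateral_halves t _ _ l m) with (3 := Hl) (4 := Hm).
  - intros n. apply psi_term_nonneg.
  - intros n. unfold t. rewrite (psi_term_neg q a q b c d s) by assumption.
    destruct W as [Wn Wd]. rewrite !Forall_cons_iff in Wn, Wd.
    destruct Wn as [W1 [W2 [W3 [W4 [W5 _]]]]]. destruct Wd as [V1 [V2 [V3 [V4 [V5 _]]]]].
    (* Splitting off the first factors brings the reflected quotient back to the original one, at
       the price of [(1 - x/q) / (1 - q/x) = - x/q]. *)
    assert (Hx : forall x : C, x <> 0 -> num_wd q x ->
      poch (x / q) q (S n) / poch (q / x) q (S n) = - (x / q) * (poch x q n / poch (q * q / x) q n)).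
    { intros x Hx0 Wx. rewrite !poch_S_l.
      replace (x / q * q) with x by (field; auto).
      replace (q / x * q) with (q * q / x) by (field; auto).
      specialize (Wx O). cbn [Cpow] in Wx.
      assert (N1 : q - x <> 0) by (apply (neq_0_scale q _ _ Hq0 Wx); field; auto).
      rewrite Cdiv_mult_mult. f_equal.
      assert (N2 : x - q <> 0) by (intros E'; apply N1; replace (q - x) with (- (x - q)) by ring; rewrite E'; ring).
      field. auto. }
    assert (Hs' : - s <> 0) by (intros E'; apply Hs; replace s with (- - s) by ring; rewrite E'; ring).
    pose proof (Hx s Hs W1) as R1. pose proof (Hx (- s) Hs' W2) as R2.
    pose proof (Hx b Hb W3) as R3. pose proof (Hx c Hc W4) as R4. pose proof (Hx d Hd W5) as R5.
    rewrite !Cdiv_mult_mult, R1, R2, R3, R4, R5.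
    replace (q * q / - s) with (- (q * q / s)) by (field; auto).
    unfold u, wp_quot. rewrite !Cdiv_mult_mult.
    set (X1 := poch s q n / _). set (X2 := poch (- s) q n / _). set (X3 := poch b q n / _).
    set (X4 := poch c q n / _). set (X5 := poch d q n / _).
    assert (Ex : (- (q * q ^ 2)) ^ S n = - q ^ 3 * (q ^ (2 * n) * (- q) ^ n)).
    { rewrite Cpow_S, Cpow_mult_r, <- Cpow_mult_l.
      replace (q ^ 2 * - q) with (- (q * q ^ 2)) by ring. ring. }
    (* The five extra factors multiply to [abcd / q^5 = q^(-2)]; with [Ex] this turns the reflected
       term into [- q^(2n+1)] times the original. *)
    assert (Ey : - (s / q) * - (- s / q) * - (b / q) * - (c / q) * - (d / q) = / q ^ 2).
    { assert (Ed : d = q * q ^ 2 / (s ^ 2 * b * c)).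
      { rewrite Hsa, <- H. field. repeat split; auto. rewrite <- Hsa. now apply Cpow_nz. }
      rewrite Ed. field. repeat split; auto. }
    rewrite Ex, (Cpow_S q (2 * n)).
    transitivity (- q ^ 3 * (q ^ (2 * n) * (- q) ^ n) * (X1 * X2 * X3 * X4 * X5)
      * (- (s / q) * - (- s / q) * - (b / q) * - (c / q) * - (d / q))); [ring|].
    rewrite Ey. generalize (q ^ (2 * n)) as Q, ((- q) ^ n) as Y. intros Q Y.
    clearbody X1 X2 X3 X4 X5. field. auto.
Qed.

(** * From the transformation to the two identities *)

Lemma phi_term_wp (q a p b c d : C) (n : nat) :
  phi_term [a; a * b / p; a * c / p; a * d / p] [p * q / b; p * q / c; p * q / d] q
    (- (p * q / a)) n
  = wp_term q a p b c d n.
Proof.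
  unfold phi_term, qpochs. cbn [map Clist_prod fold_right]. rewrite !qpoch_of_nat.
  unfold wp_term. rewrite !Cmult_1_r, !Cmult_assoc. reflexivity.
Qed.

(** Both identities at once: only the folding depends on the value of [p], so it enters as a
    hypothesis, together with the constant [w] relating [(q;q)] to [(pq;q)] at infinity. *)
Lemma psi_phi (q a p b c d s w : C) :
  (0 < Cmod q < 1)%R -> s ^ 2 = a -> s <> 0 -> b <> 0 -> c <> 0 -> d <> 0 -> p <> 0 ->
  a * b * c * d = q * p ^ 2 -> (Cmod (p * q / a) < 1)%R ->
  psi_wd [s; - s; b; c; d]
    [p * q / s; - (p * q / s); p * q / b; p * q / c; p * q / d] q ->
  den_wd q q -> den_wd q (p * q) ->
  qpochs_inf [a * q; - q; p * q / s; - (p * q / s)] q <> 0 ->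
  qpoch_inf q q = w * qpoch_inf (p * q) q ->
  let t := psi_term [s; - s; b; c; d]
    [p * q / s; - (p * q / s); p * q / b; p * q / c; p * q / d] q (- q) in
  (forall L, Ccv_series (vwp_term q p b c d s) L -> ex_bilateral t /\ bilateral t = w * L) ->
  ex_bilateral t /\
  ex_Cseries
    (phi_term [a; a * b / p; a * c / p; a * d / p] [p * q / b; p * q / c; p * q / d] q
       (- (p * q / a))) /\
  psi [s; - s; b; c; d]
    [p * q / s; - (p * q / s); p * q / b; p * q / c; p * q / d] q (- q)
  = qpochs_inf [q; - (p * q / a); q * s; - (q * s)] q
    / qpochs_inf [a * q; - q; p * q / s; - (p * q / s)] q
    * phi [a; a * b / p; a * c / p; a * d / p] [p * q / b; p * q / c; p * q / d] q
        (- (p * q / a)).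
Proof.
  intros Hq Hsa Hs Hb Hc Hd Hp H Hz W Wq Wp Hinf Hw t Ht.
  pose proof Hq as [_ Hq1]. destruct W as [_ Wd']. rewrite !Forall_cons_iff in Wd'.
  destruct Wd' as [Ws [Ws' [Wb [Wc [Wd _]]]]].
  assert (Wa : den_wd q (a * q)).
  { apply qpoch_inf_neq_0; auto. intros E. apply Hinf.
    unfold qpochs_inf. cbn [map Clist_prod fold_right]. rewrite E. ring. }
  destruct (well_poised_transform q a p b c d s) as [l [Hl HL]]; auto.
  destruct (Ht _ HL) as [Ht1 Ht2].
  assert (Hphi : Ccv_series (phi_term [a; a * b / p; a * c / p; a * d / p]
    [p * q / b; p * q / c; p * q / d] q (- (p * q / a))) l).
  { unfold Ccv_series in *. apply Ccv_ext with (2 := Hl).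
    intros n. apply Csum_ext. intros k _. symmetry. apply phi_term_wp. }
  split; [exact Ht1|]. split.
  - exists l. now apply Ccv_series_is_series.
  - unfold psi, phi. fold t. rewrite Ht2, (CSeries_unique _ _ Hphi).
    unfold prefactor, qpochs_inf. cbn [map Clist_prod fold_right]. rewrite Hw.
    rewrite !Cmult_1_r. unfold Cdiv. rewrite !Cmult_assoc. reflexivity.
Qed.

Theorem theorem8 :
  forall q a b c d sa : C,
  (0 < Cmod q < 1)%R ->
  sa ^ 2 = a ->
  (q = a * b * c * d ->
   (Cmod (q / a) < 1)%R ->
   psi_wd [sa; - sa; b; c; d] [q / sa; - (q / sa); q / b; q / c; q / d] q ->
   phi_wd [q / b; q / c; q / d] q ->
   qpochs_inf [a * q; - q; q / sa; - (q / sa)] q <> RtoC 0 ->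
   ex_bilateral
     (psi_term [sa; - sa; b; c; d] [q / sa; - (q / sa); q / b; q / c; q / d] q (- q)) /\
   ex_Cseries
     (phi_term [a; a * b; a * c; a * d] [q / b; q / c; q / d] q (- (q / a))) /\
   psi [sa; - sa; b; c; d] [q / sa; - (q / sa); q / b; q / c; q / d] q (- q)
   = qpochs_inf [q; - (q / a); q * sa; - (q * sa)] q
     / qpochs_inf [a * q; - q; q / sa; - (q / sa)] q
     * phi [a; a * b; a * c; a * d] [q / b; q / c; q / d] q (- (q / a)))
  /\
  (q ^ 3 = a * b * c * d ->
   (Cmod (q ^ 2 / a) < 1)%R ->
   psi_wd [sa; - sa; b; c; d]
          [q ^ 2 / sa; - (q ^ 2 / sa); q ^ 2 / b; q ^ 2 / c; q ^ 2 / d] q ->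
   phi_wd [q ^ 2 / b; q ^ 2 / c; q ^ 2 / d] q ->
   qpochs_inf [a * q; - q; q ^ 2 / sa; - (q ^ 2 / sa)] q <> RtoC 0 ->
   ex_bilateral
     (psi_term [sa; - sa; b; c; d]
        [q ^ 2 / sa; - (q ^ 2 / sa); q ^ 2 / b; q ^ 2 / c; q ^ 2 / d] q (- q)) /\
   ex_Cseries
     (phi_term [a; a * b / q; a * c / q; a * d / q]
        [q ^ 2 / b; q ^ 2 / c; q ^ 2 / d] q (- (q ^ 2 / a))) /\
   psi [sa; - sa; b; c; d]
       [q ^ 2 / sa; - (q ^ 2 / sa); q ^ 2 / b; q ^ 2 / c; q ^ 2 / d] q (- q)
   = qpochs_inf [q; - (q ^ 2 / a); q * sa; - (q * sa)] q
     / qpochs_inf [a * q; - q; q ^ 2 / sa; - (q ^ 2 / sa)] q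
     * phi [a; a * b / q; a * c / q; a * d / q]
           [q ^ 2 / b; q ^ 2 / c; q ^ 2 / d] q (- (q ^ 2 / a))).
Proof.
  intros q a b c d s Hq Hsa. pose proof Hq as [Hq0' Hq1].
  assert (Hq0 : q <> 0) by now apply Cmod_gt_0.
  (* A nonzero product forces every parameter, and the square root [s], to be nonzero, which
     justifies all the quotients. *)
  assert (Hnz : forall r : C, r <> 0 -> r = a * b * c * d -> s <> 0 /\ b <> 0 /\ c <> 0 /\ d <> 0).
  { intros r Hr E. rewrite <- Hsa in E.
    repeat split; intros E0; apply Hr; rewrite E, E0; ring. }
  split; intros H Hz W Wphi Hinf.
  - destruct (Hnz q Hq0 H) as [Hs [Hb [Hc Hd]]].
    assert (Wq : den_wd q q) by now inversion Wphi.
    pose proof (psi_phi q a 1 b c d s 1) as G. pose proof (psi_base_1 q a b c d s) as G1.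
    cbv zeta in G1. rewrite !Cmult_1_l, ?Cdiv_1_r, ?Cpow_1_l, ?Cmult_1_r in *.
    apply G; auto.
    + apply C1_nz.
    + intros L HL. rewrite Cmult_1_l. now apply G1.
  - assert (E : q ^ 2 = q * q) by ring.
    assert (Hq3 : q ^ 3 <> 0) by now apply Cpow_nz.
    destruct (Hnz _ Hq3 H) as [Hs [Hb [Hc Hd]]].
    assert (Wq : den_wd q q) by now inversion Wphi.
    assert (H' : a * b * c * d = q * q ^ 2) by (rewrite <- H; ring).
    rewrite E in Hz, W, Wphi, Hinf |- *.
    apply (psi_phi q a q b c d s (1 - q)); auto.
    + pose proof (den_wd_shift q q 1 Wq) as W2. now rewrite Cpow_1_r in W2.
    (* Here [w = 1 - q] is the first factor of the infinite product; it matches the normalisation in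
       [vwp_q_quot]. *)
    + rewrite (qpoch_inf_shift q q 1 Hq1), poch_S, poch_0. cbn [Cpow].
      rewrite !Cmult_1_r, Cmult_1_l. reflexivity.
    + intros L HL. now apply (psi_base_q q a b c d s).
Qed.
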